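(* For any integers $m \geq 2$, $n \geq 4$ and $1 \leq h \leq n-3$, there are constants $C_{m,n,h}$ and $D_{m,n,h}$ such that for every prime $p$ (assuming $p > n$ if $m > 2$) and every positive integer power $q = p^r$, \[ \Bigg| \frac{1}{q^n} \sum_{f \in M_n(\mathbb{F}_q)} \Big( \sum_{\substack{g \in \mathbb{F}_q[x]\\ \deg g \le h}} [\Lambda(f+g) - 1] \Big)^m \Bigg| \leq C_{m,n,h}\, q^{(h+1)(m-1)} \] and \[ \Bigg| \frac{1}{q^n} \sum_{f \in M_n(\mathbb{F}_q)} \Big( \sum_{\substack{g \in \mathbb{F}_q[x]\\ \deg g \le h}} \mu(f+g) \Big)^m \Bigg| \leq D_{m,n,h}\, q^{(h+1)(m-1)}. \]
   Context: $M_n(\mathbb{F}_q) \subset \mathbb{F}_q[x]$ is the set of monic polynomials of degree $n$. The inner sums range over all $g \in \mathbb{F}_q[x]$ with $\deg g \le h$ (including $g = 0$). The von Mangoldt function on $\mathbb{F}_q[x]$ is $\Lambda(f) = \deg(P)$ if $f = P^k$ for some irreducible $P$ and $k \ge 1$, and $\Lambda(f) = 0$ otherwise. The Möbius function is $\mu(f) = 0$ if $f$ is not squarefree and $\mu(f) = (-1)^k$ if $f$ is squarefree with $k$ distinct irreducible factors in $\mathbb{F}_q[x]$. *)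

(* Defs.v *)
From HB Require Import structures.
From mathcomp Require Import all_boot all_order all_algebra.
From Stdlib Require Import ClassicalEpsilon.
Set Implicit Arguments. Unset Strict Implicit. Unset Printing Implicit Defensive.
Import Order.TTheory GRing.Theory Num.Theory.
Local Open Scope ring_scope.

Section Arith.
Variable F : finFieldType.

Definition is_prime_power_of (f : {poly F}) (d : nat) : Prop :=
  exists (P : {poly F}) (k : nat),
    irreducible_poly P /\ (0 < k)%N /\ f = P ^+ k /\ d = (size P).-1.

Definition vonMangoldt (f : {poly F}) : nat :=
  match excluded_middle_informative (exists d, is_prime_power_of f d) with
  | left H => proj1_sig (constructive_indefinite_description _ H)
  | right _ => 0%N
  end.

Definition sqfree_factorization (f : {poly F}) (s : seq {poly F}) : Prop :=
  f != 0 /\ (forall P, P \in s -> P \is monic /\ irreducible_poly P) /\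
  uniq s /\ f = lead_coef f *: \prod_(P <- s) P.

Definition moebius (f : {poly F}) : int :=
  match excluded_middle_informative (exists s, sqfree_factorization f s) with
  | left H => (-1) ^+ size (proj1_sig (constructive_indefinite_description _ H))
  | right _ => 0
  end.

End Arith.

(* Main.v *)
Require Import Defs.
From HB Require Import structures.
From mathcomp Require Import all_boot all_order all_algebra.
From mathcomp Require Import all_fingroup all_field all_character.
From mathcomp Require Import ring zify.
From Stdlib Require Import ClassicalEpsilon.
Set Implicit Arguments. Unset Strict Implicit. Unset Printing Implicit Defensive.
Import Order.TTheory GRing.Theory Num.Theory.
Local Open Scope ring_scope.

(** The inner sums are trivially O(q^(h+1)), so the case m = 2 implies all others.
    Put S = n - h - 1. An interval of length q^(h+1) around f consists of the monic
    polynomials of degree n whose reversed polynomial has the same class as that of f in the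
    group G of units 1 + O(T) of F_q[T]/T^(S+1). By Parseval on G, the case m = 2 is a bound
    O(q^(n/2)) for the sums of Lambda(f) chi(f) and mu(f) chi(f) over monic f of degree n,
    where chi is a nontrivial character of G. The L-function of chi is a polynomial of
    degree at most S, so this is the Riemann hypothesis for its inverse roots; for that it
    suffices to bound the sums of Lambda chi in all large even degrees 2k by O(q^k).
    Such a sum counts t in F_(q^2k) by the class of their characteristic polynomial, that is,
    solutions y = 1 + O(T) of y^(q) = (1 - t T) y mod T^(S+1) with y^(q^2k) = c y.
    These are the fixed points of a twisted Frobenius on a curve with one, totally
    ramified, place at infinity; they are counted by the method of Stepanov and Bombieri. *)

(** * The curve and its functions *)

(** The curve is the pullback of the Lang map [y |-> y^(q) / y], on the group of truncated series
    [1 + O(T)], along the line [1 - t T]. It is thus a Galois cover of the [t]-line with group [G],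
    and a class [c] acts on it by multiplication; this is why one bound serves all twists.

    Pole orders are formal weights: no valuation and no Riemann-Roch theorem enters. What replaces
    them is that distinct monomials have distinct weights, that weights add under multiplication up
    to terms of lower weight, that the monomials are linearly independent as functions on points,
    and that all but finitely many integers are weights. The single, totally ramified place at
    infinity makes this possible.

    Even degrees are natural for the method because [q^(2k)] is the square of [r = q^k]: raising
    [b_j b_i^r] to the power [r] gives [b_j^r b_i^(r^2)], and at a fixed point [b_i^(r^2)] becomes
    [b_i(c y)], of far smaller pole order. They lose nothing, as the sums in degree [2k] are up to
    sign the power sums of the squared inverse roots. *)

Section Tower.
Variables (K : closedFieldType) (q : nat).
Hypothesis q_gt1 : (1 < q)%N.
Hypothesis q_pchar : [pchar K].-nat q.

(* [curve s] is the affine curve with coordinates [y_1, ..., y_(s+1)], the coefficients of a *)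
(* truncated power series [y = 1 + O(T)], given by [y^(q) = (1 - t T) y] with [t = y_1 - y_1^q]. *)
(* It is a tower of Artin-Schreier covers of the [y_1]-line, totally ramified at infinity: *)
(* [theta s] is the pole order of [y_(s+1)] there, [pole s n] says that [n] is a pole order, and *)
(* [pmon s n] is the monomial of pole order [n] in which [y_2, y_3, ...] have exponents below [q]. *)
Fixpoint theta s : nat := if s is s'.+1 then (q * theta s').+1 else 1.

Fixpoint pole s n : bool :=
  if s is s'.+1 then
    (n %% q * theta s <= n)%N && pole s' ((n - n %% q * theta s) %/ q)%N
  else true.

Fixpoint pmon s n (y : {poly K}) : K :=
  if s is s'.+1 then
    pmon s' ((n - n %% q * theta s) %/ q)%N y * y`_s.+1 ^+ (n %% q)%N
  else y`_1 ^+ n.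

Definition curve s (y : {poly K}) : Prop :=
  y`_0 = 1 /\ forall j, (0 < j <= s)%N ->
    y`_j.+1 ^+ q = y`_j.+1 + (y`_1 ^+ q - y`_1) * y`_j.

(* Functions of pole order less than [d], and functions with leading term [pmon s d]. *)
Definition Lspace s d (f : {poly K} -> K) : Prop :=
  exists p : {poly K}, [/\ (size p <= d)%N, forall n, p`_n != 0 -> pole s n
    & forall y, curve s y -> f y = \sum_(n < d) p`_n * pmon s n y].

Definition Lead s d (f : {poly K} -> K) : Prop :=
  pole s d /\ Lspace s d (fun y => f y - pmon s d y).

(** At level [s] the coordinate [y_1] has order [q ^ s], so the right side is the order of
    [y_1^q y_(s+1)], the main term in the equation for [y_(s+2)]. Times [q], it is the order of
    [y_(s+2)^q] one level up. *)
Lemma theta_expn s : theta s.+1 = (q ^ s.+1 + theta s)%N.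
Proof.
elim: s => [|s IH]; first by rewrite /= expn1; lia.
by rewrite [LHS]/= -/(theta s.+1) {1}IH mulnDr -expnS -addnS.
Qed.

(** This congruence is the source of total ramification. It lets [n %% q] be read as the exponent of
    the last coordinate, so that a pole order determines its monomial. *)
Lemma theta_mod s : (theta s.+1 = 1 %[mod q])%N.
Proof. by rewrite /= -addn1 mulnC modnMDl. Qed.

Lemma wt_mod s g e : (e < q)%N -> ((q * g + e * theta s.+1) %% q)%N = e.
Proof.
move=> lt; rewrite mulnC modnMDl -modnMmr theta_mod modnMmr muln1.
exact: modn_small.
Qed.

Lemma wt_div s g e : (e < q)%N ->
  ((q * g + e * theta s.+1 - e * theta s.+1) %/ q)%N = g.
Proof. by move=> lt; rewrite addnK mulKn //; lia. Qed.

Lemma pole_wt s g e : (e < q)%N -> pole s.+1 (q * g + e * theta s.+1) = pole s g.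
Proof. by move=> lt; rewrite /= -/(theta s.+1) wt_mod // leq_addl wt_div. Qed.

Lemma pmon_wt s g e y : (e < q)%N ->
  pmon s.+1 (q * g + e * theta s.+1) y = pmon s g y * y`_s.+2 ^+ e.
Proof. by move=> lt; rewrite /= -/(theta s.+1) wt_mod // wt_div. Qed.

Lemma pole_decomp s n : pole s.+1 n -> exists g e,
  [/\ (e < q)%N, pole s g & n = (q * g + e * theta s.+1)%N].
Proof.
rewrite [pole _ _]/= -/(theta s.+1) => /andP[le Gg].
exists ((n - n %% q * theta s.+1) %/ q)%N, (n %% q)%N.
split=> //; first by rewrite ltn_mod; lia.
have d : (q %| n - n %% q * theta s.+1)%N.
  rewrite -eqn_mod_dvd //.
  by rewrite -modnMmr theta_mod modnMmr muln1 modn_mod.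
by rewrite mulnC divnK // subnK.
Qed.

(** * Spaces of functions of bounded pole order *)

Lemma curve_le s s' y : (s' <= s)%N -> curve s y -> curve s' y.
Proof. by move=> le [y0 H]; split=> // j /andP[j0 js]; apply: H; lia. Qed.

Lemma Lspace_ext s d f g : (forall y, curve s y -> f y = g y) -> Lspace s d f -> Lspace s d g.
Proof. by move=> E [p [sp Gp Hp]]; exists p; split=> // y Cy; rewrite -E // Hp. Qed.

Lemma Lspace_mono s d d' f : (d <= d')%N -> Lspace s d f -> Lspace s d' f.
Proof.
move=> le [p [sp Gp Hp]]; exists p; split=> //; first exact: leq_trans le.
move=> y Cy; rewrite Hp // (big_ord_widen _ (fun n => p`_n * pmon s n y) le).
rewrite [RHS](bigID (fun i : 'I_d' => i < d)%N) /= [X in _ = _ + X]big1 ?addr0 //.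
by move=> i; rewrite -leqNgt => di; rewrite nth_default ?mul0r // (leq_trans sp).
Qed.

Lemma Lspace_zero s d : Lspace s d (fun _ => 0).
Proof.
exists 0; split; first by rewrite size_poly0.
  by move=> n; rewrite coef0 eqxx.
by move=> y _; rewrite big1 // => i _; rewrite coef0 mul0r.
Qed.

Lemma Lspace_add s d f g : Lspace s d f -> Lspace s d g -> Lspace s d (fun y => f y + g y).
Proof.
move=> [p [sp Gp Hp]] [r [sr Gr Hr]]; exists (p + r); split.
- by rewrite (leq_trans (size_polyD _ _)) // geq_max sp.
- move=> n; rewrite coefD; have [->|/Gp //] := eqVneq p`_n 0.
  by rewrite add0r => /Gr.
- move=> y Cy; rewrite Hp // Hr // -big_split; apply: eq_bigr => i _.
  by rewrite coefD mulrDl.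
Qed.

Lemma Lspace_scale s d a f : Lspace s d f -> Lspace s d (fun y => a * f y).
Proof.
move=> [p [sp Gp Hp]]; exists (a *: p); split.
- exact: leq_trans (size_scale_leq _ _) sp.
- by move=> n; rewrite coefZ mulf_eq0 negb_or => /andP[_ /Gp].
- move=> y Cy; rewrite Hp // mulr_sumr; apply: eq_bigr => i _.
  by rewrite coefZ mulrA.
Qed.

Lemma Lspace_sum s d (I : Type) (r : seq I) (P : pred I) (f : I -> {poly K} -> K) :
  (forall i, P i -> Lspace s d (f i)) -> Lspace s d (fun y => \sum_(i <- r | P i) f i y).
Proof.
move=> H; elim: r => [|i r IH].
  by apply: Lspace_ext (Lspace_zero s d) => y _; rewrite big_nil.
have [Pi|Pi] := boolP (P i).
  by apply: Lspace_ext (Lspace_add (H i Pi) IH) => y _; rewrite big_cons Pi.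
by apply: Lspace_ext IH => y _; rewrite big_cons (negbTE Pi).
Qed.

Lemma Lspace_bas s n : pole s n -> Lspace s n.+1 (pmon s n).
Proof.
move=> Gn; exists 'X^n; split; first by rewrite size_polyXn.
  by move=> k; rewrite coefXn; have [->//|_] := eqVneq k n; rewrite eqxx.
move=> y _; rewrite big_ord_recr /= coefXn eqxx mul1r big1 ?add0r // => i _.
by rewrite coefXn ltn_eqF ?mul0r.
Qed.

Lemma Lspace_ind s d f (Q : ({poly K} -> K) -> Prop) :
    (forall f g, (forall y, curve s y -> f y = g y) -> Q f -> Q g) ->
    Q (fun _ => 0) -> (forall f g, Q f -> Q g -> Q (fun y => f y + g y)) ->
    (forall a n, (n < d)%N -> pole s n -> Q (fun y => a * pmon s n y)) ->
  Lspace s d f -> Q f.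
Proof.
move=> Qe Q0 QD Qb [p [sp Gp Hp]].
apply: (Qe (fun y => \sum_(n < d) p`_n * pmon s n y)) => [y /Hp -> //|].
elim: (index_enum _) => [|i r IH].
  by apply: Qe Q0 => y _; rewrite big_nil.
have [pi0|/Gp Gi] := eqVneq p`_i 0.
  by apply: Qe IH => y _; rewrite big_cons pi0 mul0r add0r.
by apply: Qe (QD _ _ (Qb p`_i i _ Gi) IH) => // y _; rewrite big_cons.
Qed.

Lemma Lspace_lift s d f e : Lspace s d f -> (e < q)%N ->
  Lspace s.+1 (q * d + e * theta s.+1) (fun y => f y * y`_s.+2 ^+ e).
Proof.
move=> Vf eq; elim/Lspace_ind: Vf => [{}f g E|||a n nd Gn].
- by apply: Lspace_ext => y /(curve_le (leqnSn s)) /E ->.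
- by apply: Lspace_ext (Lspace_zero _ _) => y _; rewrite mul0r.
- by move=> {}f g Vf Vg; apply: Lspace_ext (Lspace_add Vf Vg) => y _; rewrite mulrDl.
have Gb : pole s.+1 (q * n + e * theta s.+1) by rewrite pole_wt.
apply: Lspace_ext (Lspace_mono _ (Lspace_scale a (Lspace_bas Gb))) => [y _|].
  by rewrite pmon_wt // mulrA.
by rewrite -addSn leq_add2r -addn1 (leq_trans (leq_add (leqnn _) (ltnW q_gt1))) // -mulnSr leq_mul.
Qed.

Lemma Lead_ext s d f g : (forall y, curve s y -> f y = g y) -> Lead s d f -> Lead s d g.
Proof. by move=> E [Gd H]; split=> //; apply: Lspace_ext H => y /E ->. Qed.

Lemma Lead_bas s n : pole s n -> Lead s n (pmon s n).
Proof. by move=> Gn; split=> //; apply: Lspace_ext (Lspace_zero s n) => y _; rewrite subrr. Qed.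

Lemma Lead_V s d f : Lead s d f -> Lspace s d.+1 f.
Proof.
move=> [Gd H]; apply: Lspace_ext (Lspace_add (Lspace_mono (leqnSn d) H) (Lspace_bas Gd)) => y _.
exact: subrK.
Qed.

Lemma Lead_addlow s d f g : Lead s d f -> Lspace s d g -> Lead s d (fun y => f y + g y).
Proof.
move=> [Gd H] Vg; split=> //; apply: Lspace_ext (Lspace_add H Vg) => y _.
by rewrite addrAC.
Qed.

Lemma Lead_lift s d f e : Lead s d f -> (e < q)%N ->
  Lead s.+1 (q * d + e * theta s.+1) (fun y => f y * y`_s.+2 ^+ e).
Proof.
move=> [Gd H] eq; split; first by rewrite pole_wt.
by apply: Lspace_ext (Lspace_lift H eq) => y _; rewrite pmon_wt // mulrBl.
Qed.

(** * Products and leading terms *)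

Section MulLevel.
Variable s : nat.
Hypothesis pmon_mul : forall i j, pole s i -> pole s j ->
  Lead s (i + j) (fun y => pmon s i y * pmon s j y).

(** Multiplicativity of the monomials is a section hypothesis because the induction in [pmon_mul]
    already multiplies functions of the previous level. The predecessor appears since orders at most
    [d - 1] and [d' - 1] add up to at most [d + d' - 2]. *)
Lemma Lspace_mul_of d d' f g : Lspace s d f -> Lspace s d' g ->
  Lspace s (d + d').-1 (fun y => f y * g y).
Proof.
move=> Vf Vg; elim/Lspace_ind: Vf => [{}f f' E|||a n nd Gn].
- by apply: Lspace_ext => y /E ->.
- by apply: Lspace_ext (Lspace_zero _ _) => y _; rewrite mul0r.
- by move=> {}f f' Vf Vf'; apply: Lspace_ext (Lspace_add Vf Vf') => y _; rewrite mulrDl.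
elim/Lspace_ind: Vg => [{}g g' E|||b m md Gm].
- by apply: Lspace_ext => y /E ->.
- by apply: Lspace_ext (Lspace_zero _ _) => y _; rewrite mulr0.
- by move=> {}g g' Vg Vg'; apply: Lspace_ext (Lspace_add Vg Vg') => y _; rewrite mulrDr.
have := Lspace_scale (a * b) (Lead_V (pmon_mul Gn Gm)).
move=> /(Lspace_mono (d' := (d + d').-1)) H; apply: Lspace_ext (H _) => [y _|]; last by lia.
by rewrite mulrACA.
Qed.

Lemma Lead_mul_of d d' f g : Lead s d f -> Lead s d' g ->
  Lead s (d + d') (fun y => f y * g y).
Proof.
move=> Mf Mg; have [Gd Hf] := Mf; have [Gd' Hg] := Mg.
have H1 : Lspace s (d + d') (fun y => (f y - pmon s d y) * g y).
  by have := Lspace_mul_of Hf (Lead_V Mg); rewrite addnS.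
have H2 : Lspace s (d + d') (fun y => pmon s d y * (g y - pmon s d' y)).
  exact: Lspace_mul_of (Lspace_bas Gd) Hg.
by apply: Lead_ext (Lead_addlow (pmon_mul Gd Gd') (Lspace_add H1 H2)) => y _; ring.
Qed.

End MulLevel.

Lemma Lead_one s : Lead s 0 (fun _ => 1).
Proof.
elim: s => [|s IH].
  by apply: Lead_ext (Lead_bas _) => // y _ /=; rewrite expr0.
have := Lead_lift IH (ltnW q_gt1); rewrite muln0 add0n.
by apply: Lead_ext => y _; rewrite expr0 mulr1.
Qed.

Lemma Lead_up s d f : Lead s d f -> Lead s.+1 (q * d) f.
Proof.
move=> Mf; have := Lead_lift Mf (ltnW q_gt1); rewrite addn0.
by apply: Lead_ext => y _; rewrite expr0 mulr1.
Qed.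

Lemma Lead_first s : Lead s (q ^ s) (fun y => y`_1).
Proof.
elim: s => [|s IH]; last by rewrite expnS; apply: Lead_up.
by apply: Lead_ext (Lead_bas (n := 1) _) => // y _ /=; rewrite expr1.
Qed.

Lemma Lead_last s : Lead s (theta s) (fun y => y`_s.+1).
Proof.
case: s => [|s]; first exact: Lead_first 0.
have := Lead_lift (Lead_one s) q_gt1; rewrite muln0 mul1n.
by apply: Lead_ext => y _; rewrite mul1r expr1.
Qed.

(** Only an exponent [e + e' >= q] of the last coordinate needs an argument. There [y_(s+2)^q] is
    replaced by [y_(s+2) + (y_1^q - y_1) y_(s+1)], whose second term has by [theta_expn] the same
    order as [y_(s+2)^q], while the first has smaller order. *)
Lemma pmon_mul s i j : pole s i -> pole s j ->
  Lead s (i + j) (fun y => pmon s i y * pmon s j y).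
Proof.
elim: s i j => [|s IH] i j.
  move=> _ _; apply: Lead_ext (Lead_bas (n := i + j) _) => // y _ /=.
  by rewrite exprD.
have mulM := Lead_mul_of IH.
move=> /pole_decomp[g [e [eq Gg ->]]] /pole_decomp[g' [e' [eq' Gg' ->]]].
have MF := IH _ _ Gg Gg'.
have E : (q * g + e * theta s.+1 + (q * g' + e' * theta s.+1) =
  q * (g + g') + (e + e') * theta s.+1)%N by rewrite mulnDr mulnDl addnACA.
rewrite {}E; have [lt|ge] := ltnP (e + e') q.
  apply: Lead_ext (Lead_lift MF lt) => y _.
  by rewrite !pmon_wt // exprD mulrACA.
pose e2 := (e + e' - q)%N.
(* Both exponents are at most [q - 1], so the lower term, with one more factor [y_(s+2)], still has
   a reduced exponent. *)
have e2q : (e2.+1 < q)%N by rewrite /e2; lia.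
have MU : Lead s (theta s.+1) (fun y => (y`_1 ^+ q - y`_1) * y`_s.+1).
  have Me k : Lead s (k * q ^ s) (fun y => y`_1 ^+ k).
    elim: k => [|k IHk]; first by apply: Lead_ext (Lead_one s) => y; rewrite expr0.
    by rewrite mulSn; apply: Lead_ext (mulM _ _ _ _ (Lead_first s) IHk) => y; rewrite exprS.
  rewrite theta_expn expnS; apply: mulM (Lead_last s).
  apply: Lead_addlow (Me q) _.
  apply: Lspace_ext (Lspace_mono _ (Lspace_scale (-1) (Lead_V (Lead_first s)))) => [y _|].
    by rewrite mulN1r.
  by have := expn_gt0 q s; nia.
have M1 := Lead_lift (mulM _ _ _ _ MF MU) (ltnW e2q).
have M2 := Lead_V (Lead_lift MF e2q).
have -> : (q * (g + g') + (e + e') * theta s.+1 =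
  q * (g + g' + theta s.+1) + e2 * theta s.+1)%N.
  by rewrite (mulnDr q (g + g')) /e2 mulnBl -addnA subnKC // leq_mul2r ge orbT.
apply: Lead_ext (Lead_addlow M1 (Lspace_mono _ M2)).
  move=> y [_ Cy]; rewrite !pmon_wt // [RHS]mulrACA -exprD.
  have -> : (e + e' = e2 + q)%N by rewrite subnK.
  have Cs := Cy s.+1 (leqnn _).
  by rewrite [in RHS]exprD Cs exprS; ring.
rewrite (mulnDr q (g + g')) mulSn.
have : (theta s.+1 < q * theta s.+1)%N by rewrite ltn_Pmull.
by clear; lia.
Qed.

Definition Lspace_mul s := Lspace_mul_of (@pmon_mul s).
Definition Lead_mul s := Lead_mul_of (@pmon_mul s).

Lemma Lead_exp s d f k : Lead s d f -> Lead s (k * d) (fun y => f y ^+ k).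
Proof.
move=> Mf; elim: k => [|k IH].
  by apply: Lead_ext (Lead_one s) => y _; rewrite expr0.
by rewrite mulSn; apply: Lead_ext (Lead_mul Mf IH) => y _; rewrite exprS.
Qed.

(** * Points of the tower and independence of the monomials *)

Lemma curve_update s y a :
  curve s y -> a ^+ q = a + (y`_1 ^+ q - y`_1) * y`_s.+1 ->
  curve s.+1 (y + (a - y`_s.+2) *: 'X^(s.+2)).
Proof.
move=> [y0 Cy] Ha.
have co j : (y + (a - y`_s.+2) *: 'X^(s.+2))`_j = if j == s.+2 then a else y`_j.
  rewrite coefD coefZ coefXn; case: eqP => [->|_]; last by rewrite mulr0 addr0.
  by rewrite mulr1 addrC subrK.
split; first by rewrite co.
move=> j /andP[j0]; rewrite leq_eqVlt => /orP[/eqP ->|js].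
  by rewrite !co eqxx /= ltn_eqF.
by rewrite !co /= !ltn_eqF ?ltnS //; [apply: Cy; lia | lia].
Qed.

Lemma pmon_coord s n (y z : {poly K}) : (forall j, (0 < j <= s.+1)%N -> y`_j = z`_j) ->
  pmon s n y = pmon s n z.
Proof.
elim: s n => [|s IH] n E; first by rewrite /= E.
by rewrite /= (IH _ _) ?E ?leqnn // => j /andP[j0 js]; apply: E; lia.
Qed.

(** As [q] is zero in [K], the derivative of [x^q - x - a] is [-1], so the roots are simple. *)
Lemma artin_schreier_roots (a : K) : exists r : seq K,
  [/\ uniq r, size r = q & forall x, (x \in r) = (x ^+ q == x + a)].
Proof.
pose P : {poly K} := 'X^q - ('X + a%:P).
have sXa : size ('X + a%:P) = 2 by rewrite size_XaddC.
have sP : size P = q.+1.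
  by rewrite size_polyDl ?size_polyXn // size_polyN sXa ltnS.
have mP : lead_coef P = 1.
  by rewrite lead_coefDl ?lead_coefXn // size_polyN sXa size_polyXn ltnS.
have [r Pr] := closed_field_poly_normal P; rewrite mP scale1r in Pr.
exists r; split.
- rewrite -separable_prod_XsubC -Pr unlock.
  have -> : P^`() = -1.
    rewrite derivB derivXn derivD derivX derivC addr0.
    have -> : 'X^(q.-1) *+ q = 0 :> {poly K}.
      rewrite -mulr_natl -polyC_natr.
      have p_char := pnatPpi q_pchar (etrans (pi_pdiv q) q_gt1).
      suff /eqP -> : q%:R == 0 :> K by rewrite mul0r.
      by rewrite -(dvdn_pcharf p_char) pdiv_dvd.
    by rewrite add0r.
  by rewrite -scaleN1r coprimepZr ?coprimep1 // oppr_eq0 oner_eq0.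
- by apply/eqP; rewrite -eqSS -sP Pr size_prod_XsubC.
- move=> x; rewrite -root_prod_XsubC -Pr rootE !hornerE.
  by rewrite subr_eq0.
Qed.

(** Above a point of level [s] the last coordinate takes [q] values, and the relation is a
    polynomial of degree less than [q] in it. All its coefficients therefore vanish, and they are
    relations of level [s]. *)
Lemma pmon_indep s (p : {poly K}) : (forall n, p`_n != 0 -> pole s n) ->
  (forall y, curve s y -> \sum_(n < size p) p`_n * pmon s n y = 0) -> p = 0.
Proof.
elim: s p => [|s IH] p Gp Hp.
  apply/eqP; apply: contraT => /closed_nonrootP[x].
  case/negP; rewrite rootE horner_coef; apply/eqP.
  have c1 : (1 + x *: 'X : {poly K})`_1 = x.
    by rewrite coefD coef1 coefZ coefX mulr1 add0r.
  rewrite -[RHS](Hp (1 + x *: 'X)) /=; last first.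
    by split=> [|j]; [rewrite coefD coef1 coefZ coefX mulr0 addr0 | lia].
  by rewrite c1.
(* [pe e] is the part of [p] that multiplies [y_(s+2)^e], indexed by pole orders of level [s]. *)
pose pe e : {poly K} := \poly_(g < size p) p`_(q * g + e * theta s.+1).
have pe_coef e g : (pe e)`_g = p`_(q * g + e * theta s.+1).
  rewrite coef_poly; case: ltnP => // le; rewrite nth_default //.
  by rewrite (leq_trans le) // (leq_trans _ (leq_addr _ _)) // leq_pmull; lia.
have pe0 e : (e < q)%N -> pe e = 0.
  move=> eq; apply: IH => [g|y Cy].
    by rewrite pe_coef => /Gp; rewrite pole_wt.
  pose A e := \sum_(g < size p) (pe e)`_g * pmon s g y.
  have [r [ur sr Hr]] := artin_schreier_roots ((y`_1 ^+ q - y`_1) * y`_s.+1).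
  pose P : {poly K} := \poly_(e < q) A e.
  have : P = 0.
    apply: (@roots_geq_poly_eq0 _ _ r) => //; last by rewrite sr size_poly.
    apply/allP => a; rewrite Hr => /eqP Ca; rewrite rootE horner_poly; apply/eqP.
    set z : {poly K} := y + (a - y`_s.+2) *: 'X^(s.+2).
    have Cz := curve_update Cy Ca.
    rewrite -[RHS](Hp z Cz).
    have zE : z`_s.+2 = a.
      by rewrite coefD coefZ coefXn eqxx mulr1 addrC subrK.
    have bz g : pmon s g z = pmon s g y.
      apply: pmon_coord => j /andP[_ js]; rewrite coefD coefZ coefXn ltn_eqF //.
      by rewrite mulr0 addr0.
    pose phi (x : 'I_q * 'I_(size p)) := (q * x.2 + x.1 * theta s.+1)%N.
    transitivity (\sum_x p`_(phi x) * (pmon s x.2 y * a ^+ x.1)).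
      rewrite -(pair_bigA _ (fun (e' : 'I_q) (g : 'I_(size p)) =>
        p`_(phi (e', g)) * (pmon s g y * a ^+ e'))) /=.
      apply: eq_bigr => e' _; rewrite mulr_suml; apply: eq_bigr => g _.
      by rewrite pe_coef mulrA.
    (* A pole order with nonzero coefficient comes from exactly one pair, and pairs of order beyond
       the size of [p] have coefficient zero. *)
    transitivity (\sum_(n < size p) \sum_(x | phi x == n)
        p`_n * (pmon s x.2 y * a ^+ x.1)).
      rewrite (exchange_big_dep predT) //=; apply: eq_bigr => x _.
      have [lt|ge] := ltnP (phi x) (size p).
        by rewrite (big_pred1 (Ordinal lt)) // => n; rewrite eq_sym.
      rewrite nth_default // mul0r big1 // => n /eqP E.
      by move: (ltn_ord n); rewrite -E ltnNge ge.
    apply: eq_bigr => n _; rewrite -mulr_sumr.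
    have [->|pn] := eqVneq p`_n 0; first by rewrite !mul0r.
    have [g [e' [eq' Gg En]]] := pole_decomp (Gp n pn).
    have gn : (g < size p)%N.
      by apply: leq_ltn_trans (ltn_ord n); rewrite En; nia.
    rewrite (big_pred1 (Ordinal eq', Ordinal gn)) => [|[x1 x2]].
      by rewrite En pmon_wt // zE bz.
    rewrite /phi En /=; apply/eqP/eqP => [E|[-> ->] //].
    have E1 : x1 = e' :> nat by rewrite -(wt_mod s x2 (ltn_ord x1)) E wt_mod.
    congr pair; apply: val_inj => //=.
    by rewrite -(wt_div s x2 (ltn_ord x1)) E E1 wt_div.
  move/(congr1 (fun P : {poly K} => P`_e)); rewrite coef_poly eq coef0 => A0; rewrite -[RHS]A0.
  have sz : (size (pe e) <= size p)%N := size_poly _ _.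
  rewrite /A (big_ord_widen _ (fun n => (pe e)`_n * pmon s n y) sz).
  rewrite [RHS](bigID (fun i : 'I_(size p) => i < size (pe e))%N) /=.
  rewrite [X in _ = _ + X]big1 ?addr0 // => i.
  by rewrite -leqNgt => di; rewrite nth_default ?mul0r.
apply/polyP => n; rewrite coef0; apply/eqP; apply: contraT => pn.
have /pole_decomp[g [e [eq Gg En]]] := Gp n pn.
by move: pn; rewrite En -pe_coef pe0 // coef0 eqxx.
Qed.

Lemma Lead_neq0 s d f : Lead s d f -> ~ (forall y, curve s y -> f y = 0).
Proof.
move=> [Gd [p [sp Gp Hp]]] f0.
pose r := p + 'X^d.
have rn n : r`_n = if (n < d)%N then p`_n else (n == d)%:R.
  rewrite coefD coefXn; have [lt|gt|->] := ltngtP n d.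
  - by rewrite addr0.
  - by rewrite nth_default ?add0r // (leq_trans sp) // ltnW.
  - by rewrite nth_default ?add0r.
have sr : size r = d.+1.
  by rewrite /r addrC size_polyDl ?size_polyXn // ltnS.
suff r0 : r = 0 by move: sr; rewrite r0 size_poly0.
apply: (@pmon_indep s) => [n|y Cy].
  rewrite rn; case: ltngtP => [_ /Gp //|_|-> //]; first by rewrite eqxx.
rewrite sr big_ord_recr /= rn ltnn eqxx mul1r.
under eq_bigr => i _ do rewrite rn ltn_ord.
by rewrite -Hp // f0 // sub0r addNr.
Qed.

(** * Counting pole orders *)

Lemma pole_cofinite s : exists m0, forall n, (m0 <= n)%N -> pole s n.
Proof.
elim: s => [|s [m0 IH]]; first by exists 0%N.
exists (q * m0 + q * theta s.+1)%N => n le.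
set e := (n %% q)%N.
have eq : (e < q)%N by rewrite ltn_mod; lia.
have eT : (e * theta s.+1 <= q * theta s.+1)%N by rewrite leq_mul2r ltnW ?orbT.
have et : (e * theta s.+1 <= n)%N.
  exact: leq_trans eT (leq_trans (leq_addl _ _) le).
rewrite /= -/(theta s.+1) -/e et /=; apply: IH.
have H : (q * m0 + e * theta s.+1 <= n)%N by apply: leq_trans le; rewrite leq_add2l.
by rewrite leq_divRL ?(ltnW q_gt1) // leq_subRL // addnC (mulnC m0).
Qed.

Definition pole_count s m := count (pole s) (iota 0 m).

(** The number [g] of gaps plays the part of the genus: this count is the substitute for the
    Riemann-Roch theorem. *)
Lemma pole_count_eventually s : exists g m0, forall m, (m0 <= m)%N -> (pole_count s m + g = m)%N.
Proof.
have [m0 H] := pole_cofinite s; exists (m0 - pole_count s m0)%N, m0 => m le.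
have cm0 : (pole_count s m0 <= m0)%N by rewrite (leq_trans (count_size _ _)) ?size_iota.
rewrite /pole_count -(subnKC le) iotaD count_cat add0n.
have -> : count (pole s) (iota m0 (m - m0)) = (m - m0)%N.
  rewrite -[RHS](size_iota m0) -[RHS]count_predT; apply: eq_in_count => i.
  by rewrite mem_iota => /andP[/H ->].
rewrite -/(pole_count s m0); lia.
Qed.

(** * Frobenius powers and translations *)

Lemma frob_sum Q (I : Type) (r : seq I) (P : pred I) (f : I -> K) :
  [pchar K].-nat Q ->
  (\sum_(i <- r | P i) f i) ^+ Q = \sum_(i <- r | P i) f i ^+ Q.
Proof.
move=> Q_pchar; apply: (big_morph (fun x => x ^+ Q)) => [x y|].
  exact: exprDn_pchar.
by rewrite expr0n; case: Q Q_pchar.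
Qed.

Lemma coef1M (c y : {poly K}) : c`_0 = 1 -> y`_0 = 1 -> (c * y)`_1 = y`_1 + c`_1.
Proof.
by move=> c0 y0; rewrite coefM !big_ord_recr big_ord0 /= c0 y0 add0r mul1r mulr1.
Qed.

Lemma Lead_coord s j : (j <= s.+1)%N ->
  exists2 w, (w <= theta s)%N & Lead s w (fun y => y`_j).
Proof.
case: j => [_|j].
  by exists 0%N => //; apply: Lead_ext (Lead_one _) => y [-> _].
elim: s j => [|s IH] j js.
  move: js; rewrite !ltnS leqn0 => /eqP ->.
  by exists 1%N => //; exact: (Lead_first 0).
move: js; rewrite ltnS leq_eqVlt => /orP[/eqP->|/IH[w wt /Lead_up Mw]].
  by exists (theta s.+1) => //; exact: Lead_last.
by exists (q * w)%N => //=; rewrite leqW // leq_mul2l wt orbT.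
Qed.

(** Multiplication by [c] adds to each coordinate a combination of the earlier ones, which have
    smaller pole order; leading terms do not change. *)
Lemma Lead_translate s (c : {poly K}) i : c`_0 = 1 -> (forall j, c`_j ^+ q = c`_j) ->
  pole s i -> Lead s i (fun y => pmon s i (c * y)).
Proof.
move=> c0 Cc; elim: s i => [|s IH] i.
  move=> _; have M1 : Lead 0 1 (fun y : {poly K} => y`_1 + c`_1).
    apply: Lead_addlow (Lead_first 0) _.
    by apply: Lspace_ext (Lspace_scale c`_1 (Lead_V (Lead_one 0))) => y _; rewrite mulr1.
  have := Lead_exp i M1; rewrite muln1; apply: Lead_ext => y [y0 _] /=.
  by rewrite coef1M.
move=> /pole_decomp[g [e [eq Gg ->]]].
have ML : Lead s.+1 (theta s.+1) (fun y => (c * y)`_s.+2).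
  have Vl : Lspace s.+1 (theta s.+1)
      (fun y => \sum_(l < s.+2) c`_l.+1 * y`_(s.+1 - l)).
    apply: Lspace_sum => l _; apply: Lspace_scale.
    have [w wt /Lead_up/Lead_V] := Lead_coord (leq_subr l s.+1).
    by apply: Lspace_mono; rewrite /= ltnS leq_mul2l wt orbT.
  apply: Lead_ext (Lead_addlow (Lead_last s.+1) Vl) => y _.
  by rewrite coefM [in RHS]big_ord_recl c0 mul1r subn0.
apply: Lead_ext (Lead_mul (Lead_up (IH g Gg)) (Lead_exp e ML)) => y _.
by rewrite pmon_wt.
Qed.

Lemma pmon_frob s i (y z : {poly K}) Q : (forall j, (0 < j <= s.+1)%N -> z`_j = y`_j ^+ Q) ->
  pmon s i z = pmon s i y ^+ Q.
Proof.
elim: s i => [|s IH] i E; first by rewrite /= E // exprAC.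
rewrite /= exprMn (IH _ _) ?E ?leqnn // 1?exprAC // => j /andP[j0 js].
by apply: E; lia.
Qed.

(** As the orders are distinct, the term of highest order among those with nonzero coefficient
    cannot be cancelled. *)
Lemma Lead_comb s (A : finType) (f : A -> {poly K} -> K) (d : A -> nat) (x : A -> K) :
  injective d -> (forall a, Lead s (d a) (f a)) -> (exists a, x a != 0) ->
  exists a0, x a0 != 0 /\
    Lead s (d a0) (fun y => (x a0)^-1 * \sum_a x a * f a y).
Proof.
move=> dI Mf [a1 xa1].
case: (arg_maxnP (P := fun a => x a != 0) d xa1) => a0 /= xa0 max0; exists a0; split=> //.
have VS : Lspace s (d a0) (fun y => \sum_(a | a != a0) ((x a0)^-1 * x a) * f a y).
  apply: Lspace_sum => a na; have [->|xa] := eqVneq (x a) 0.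
    by apply: Lspace_ext (Lspace_zero _ _) => y _; rewrite mulr0 mul0r.
  apply: Lspace_scale; apply: Lspace_mono (Lead_V (Mf a)).
  rewrite ltn_neqAle max0 // andbT; apply: contra na => /eqP /dI ->.
  exact: eqxx.
apply: Lead_ext (Lead_addlow (Mf a0) VS) => y _.
rewrite mulr_sumr [in RHS](bigD1 a0) //= mulKf //; congr (_ + _).
by apply: eq_bigr => a _; rewrite mulrA.
Qed.

(** * Linear dependence and zeros *)

Lemma Lspace_dependent s D (A : finType) (f : A -> {poly K} -> K) :
  (forall a, Lspace s D (f a)) -> (pole_count s D < #|A|)%N ->
  exists x : A -> K, (exists a, x a != 0) /\
    forall y, curve s y -> \sum_a x a * f a y = 0.
Proof.
move=> Vf lt; have [p Hp] := fin_all_exists Vf.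
pose G := [seq n <- iota 0 D | pole s n].
pose M : 'M[K]_(#|A|, size G) := \matrix_(i, j) (p (enum_val i))`_(nth 0%N G j).
have : kermx M != 0.
  rewrite kermx_eq0 /row_free neq_ltn (leq_ltn_trans (rank_leq_col M)) //.
  by rewrite size_filter.
case/rowV0Pn => u /sub_kermxP cls_revpM u0.
exists (fun a => u 0 (enum_rank a)); split.
  have /existsP[i ui] : [exists i, u 0 i != 0].
    apply: contraR u0; rewrite negb_exists => /forallP H.
    by apply/eqP/rowP => i; rewrite mxE; apply/eqP; move: (H i); rewrite negbK.
  by exists (enum_val i); rewrite enum_valK.
have pz n : (n < D)%N -> \sum_a u 0 (enum_rank a) * (p a)`_n = 0.
  move=> nD; have [Gn|Gn] := boolP (pole s n); last first.
    rewrite big1 // => a _; have [_ Ga _] := Hp a.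
    have [->|/Ga] := eqVneq (p a)`_n 0; first by rewrite mulr0.
    by rewrite (negbTE Gn).
  have nG : n \in G by rewrite mem_filter Gn mem_iota.
  have jG : (index n G < size G)%N by rewrite index_mem.
  have := congr1 (fun N : 'rV_(size G) => N 0 (Ordinal jG)) cls_revpM.
  rewrite !mxE => E; rewrite -[RHS]E (reindex_onto enum_rank enum_val) /=.
    apply: eq_big => [a|a _]; first by rewrite enum_rankK eqxx.
    by rewrite mxE enum_rankK nth_index.
  by move=> i _; rewrite enum_valK.
move=> y Cy; transitivity (\sum_a \sum_(n < D)
    u 0 (enum_rank a) * (p a)`_n * pmon s n y).
  apply: eq_bigr => a _; have [_ _ ->//] := Hp a.
  by rewrite mulr_sumr; apply: eq_bigr => n _; rewrite mulrA.
rewrite exchange_big big1 //= => n _.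
by rewrite -mulr_suml pz ?mul0r.
Qed.

(** The function is a product of coordinate differences, one for each point of [T]. The bound on
    sizes ensures that distinct points differ in a coordinate of the curve. *)
Lemma Lspace_separate s (y : {poly K}) (T : seq {poly K}) :
    curve s y -> (size y <= s.+2)%N -> y \notin T ->
    (forall z, z \in T -> curve s z /\ (size z <= s.+2)%N) ->
  exists M f, [/\ Lspace s M f, f y != 0 & forall z, z \in T -> f z = 0].
Proof.
move=> Cy sy; elim: T => [|z T IH] /=.
  move=> _ _; exists 1%N, (fun _ => 1); split; rewrite ?oner_eq0 //.
  exact: Lead_V (Lead_one s).
rewrite inE negb_or => /andP[nyz nyT] HT.
have [M [f [Vf fy fT]]] := IH nyT (fun z' h => HT z' (mem_behead (s := z :: T) h)).
have [Cz sz] := HT z (mem_head _ _).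
have [j js yj] : exists2 j, (j < s.+2)%N & y`_j != z`_j.
  have /existsP[j yj] : [exists j : 'I_s.+2, y`_j != z`_j].
    apply: contraR nyz; rewrite negb_exists => /forallP H.
    apply/eqP/polyP => i; have [lt|ge] := ltnP i s.+2.
      by apply/eqP; move: (H (Ordinal lt)); rewrite negbK.
    by rewrite !nth_default // (leq_trans _ ge).
  by exists j.
have [w _ /Lead_V Vj] := Lead_coord (js : (j <= s.+1)%N).
have V1 := Lspace_scale (- z`_j) (Lead_V (Lead_one s)).
have V2 : Lspace s w.+1 (fun y => y`_j - z`_j).
  by apply: Lspace_ext (Lspace_add Vj (Lspace_mono _ V1)) => // x _; rewrite mulr1.
exists (M + w.+1).-1, (fun x => f x * (x`_j - z`_j)); split.
- exact: Lspace_mul.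
- by rewrite mulf_neq0 // subr_eq0.
- move=> x; rewrite inE => /orP[/eqP ->|/fT ->]; last exact: mul0r.
  by rewrite subrr mulr0.
Qed.

Definition pole_nth s m (i : 'I_(pole_count s m)) := nth 0%N [seq n <- iota 0 m | pole s n] i.

Lemma pole_nthP s m (i : 'I_(pole_count s m)) : pole s (pole_nth i) && (pole_nth i < m)%N.
Proof.
have : pole_nth i \in [seq n <- iota 0 m | pole s n].
  by rewrite mem_nth // size_filter.
by rewrite mem_filter mem_iota.
Qed.

Lemma pole_nth_inj s m : injective (@pole_nth s m).
Proof.
move=> i j /eqP; rewrite nth_uniq ?filter_uniq ?iota_uniq ?size_filter //.
by move=> /eqP /val_inj.
Qed.

(* If [f] had more than [d] zeros in [S], then the multiples of [f] of pole order less than *)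
(* [L + d] and functions separating the points of [S] would be too many to be independent. *)
Lemma size_zeros s d f (S : seq {poly K}) : Lead s d f -> uniq S ->
  (forall y, y \in S -> [/\ curve s y, (size y <= s.+2)%N & f y = 0]) ->
  (size S <= d)%N.
Proof.
move=> Mf uS HS; rewrite leqNgt; apply/negP => dS.
have sep (i : 'I_(size S)) : exists M f, [/\ Lspace s M f, f S`_i != 0 &
    forall j : 'I_(size S), j != i -> f S`_j = 0].
  have Si : S`_i \in S by rewrite mem_nth.
  have [Ci si _] := HS _ Si.
  have [||M [h [Vh hi hT]]] := @Lspace_separate s S`_i (rem S`_i S) Ci si.
  - by rewrite mem_rem_uniq // !inE eqxx.
  - by move=> z /mem_rem /HS[].
  exists M, h; split=> // j ji; apply: hT.
  by rewrite mem_rem_uniq // !inE nth_uniq // mem_nth // andbT.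
have [M sepM] := fin_all_exists sep.
have [delta Hd] := fin_all_exists sepM.
have [g [m0 cntE]] := pole_count_eventually s.
(* With [L] this large, there are [size S + (L - g)] functions in a space of dimension
   [L + d - g]. *)
pose L := (m0 + \max_i M i)%N.
pose F (a : 'I_(size S) + 'I_(pole_count s L)) y :=
  match a with inl i => delta i y | inr k => f y * pmon s (pole_nth k) y end.
have MF k : Lead s (d + pole_nth k) (F (inr k)).
  by have /andP[Gk _] := pole_nthP k; apply: Lead_mul Mf (Lead_bas Gk).
have VF a : Lspace s (L + d) (F a).
  case: a => [i|k].
    have [Vd _ _] := Hd i; apply: Lspace_mono Vd.
    have := leq_bigmax_cond (F := M) i isT; rewrite /L; lia.
  apply: Lspace_mono (Lead_V (MF k)).
  by have /andP[_ kL] := pole_nthP k; rewrite addnC ltn_add2r.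
have [|x [[a xa] xz]] := Lspace_dependent VF.
  by rewrite card_sum !card_ord; have := cntE L; have := cntE (L + d)%N; lia.
(* At the [i]-th point of [S] the multiples of [f] and all other separating functions vanish. What
   is left of the relation is a multiple of [f] with a leading term. *)
have xl i : x (inl i) = 0.
  have [Ci _ fi] := HS S`_i (mem_nth 0 (ltn_ord i)).
  have := xz _ Ci; rewrite big_sumType /= [X in _ + X]big1 ?addr0 => [|k _].
    rewrite (bigD1 i) //= big1 ?addr0 => [/eqP|j ji].
      by have [_ /negbTE di _] := Hd i; rewrite mulf_eq0 di orbF => /eqP.
    by have [_ _ ->] := Hd j; rewrite ?mulr0 // eq_sym.
  by rewrite fi mul0r mulr0.
case: a xa => [i|k xk]; first by rewrite xl eqxx.
have [|||k0 [xk0 M0]] := @Lead_comb s _ (fun k => F (inr k)) (fun k => d + pole_nth k)%N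
    (fun k => x (inr k)).
- by move=> k1 k2 /addnI /pole_nth_inj.
- exact: MF.
- by exists k.
apply: (Lead_neq0 M0) => y Cy; have := xz y Cy; rewrite big_sumType /=.
by rewrite big1 ?add0r => [->|i _]; rewrite ?xl ?mul0r ?mulr0.
Qed.

Lemma closed_expr_root (a : K) r : (0 < r)%N -> exists b, b ^+ r = a.
Proof.
move=> r0; have : size ('X^r - a%:P) != 1 by rewrite size_XnsubC // eqSS -lt0n.
by case/closed_rootP => b; rewrite rootE !hornerE subr_eq0 => /eqP <-; exists b.
Qed.

(* With [r = q^k], choose [x_ij] with [sum x_ij b_j^r b_i(c y) = 0] on the curve, which is *)
(* possible by counting dimensions. If [a_ij^r = x_ij], then [H = sum a_ij b_j b_i^r] *)
(* vanishes at every solution of [y^(r^2) = c y], because there [H^r] is the former sum. *)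
Theorem frobenius_fixed_bound s : exists B r0, forall k (c : {poly K}) (S : seq {poly K}),
  (r0 <= q ^ k)%N -> c`_0 = 1 -> (forall j, c`_j ^+ q = c`_j) -> uniq S ->
  (forall y, y \in S -> [/\ curve s y, (size y <= s.+2)%N &
     forall j, (0 < j <= s.+1)%N -> (c * y)`_j = y`_j ^+ (q ^ (2 * k))]) ->
  (size S <= q ^ (2 * k) + B * q ^ k)%N.
Proof.
have [g [m0 cntE]] := pole_count_eventually s.
exists (2 * g + 1)%N, (m0 + (g + 1) ^ 2 + 1)%N => k c S; set r := (q ^ k)%N.
move=> r_big c0 Cc uS HS.
have r_pchar : [pchar K].-nat r by rewrite pnatX q_pchar.
have r2 : (q ^ (2 * k) = r * r)%N by rewrite mul2n -addnn expnD.
have r_gt0 : (0 < r)%N by rewrite expn_gt0 ltnW.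
(* There are [(r + g + 1) * (r - g) = r^2 + r - g^2 - g] unknowns and [D - g = r^2 + g + 1]
   equations, so the unknowns prevail as soon as [r > (g + 1)^2]. This gives the threshold [r0]. *)
pose m := (r + 2 * g + 1)%N; pose D := ((r - 1) * r + m)%N.
pose A := ('I_(pole_count s m) * 'I_(pole_count s r))%type.
pose F (a : A) y := pmon s (pole_nth a.2) y ^+ r * pmon s (pole_nth a.1) (c * y).
have VF a : Lspace s D (F a).
  case: a => i j; have /andP[Gi im] := pole_nthP i; have /andP[Gj jr] := pole_nthP j.
  have := Lead_V (Lead_mul (Lead_exp r (Lead_bas Gj)) (Lead_translate c0 Cc Gi)).
  apply: Lspace_mono => /=; rewrite /D -addnS leq_add //.
  by rewrite mulnC leq_mul2r; apply/orP; right; lia.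
have [|x [[a xa] xz]] := Lspace_dependent VF.
  rewrite card_prod !card_ord.
  have E1 : (pole_count s r + g = r)%N by apply: cntE; lia.
  have E2 : (pole_count s m + g = r + 2 * g + 1)%N by apply: cntE; rewrite /m; lia.
  have E3 : (pole_count s D + g = (r - 1) * r + (r + 2 * g + 1))%N.
    by apply: cntE; rewrite (leq_trans _ (leq_addl _ _)) // /m; lia.
  move: E1 E2 E3 r_big; clear; move: (pole_count s r) (pole_count s m) (pole_count s D) => u v w.
  move=> E1 E2 E3 r_big; have {}E2 : v = (r + g + 1)%N by lia.
  have [t rt] : exists t, r = ((g + 1) ^ 2 + 1 + t)%N by exists (r - ((g + 1) ^ 2 + 1))%N; lia.
  have {}E1 : u = ((g + 1) ^ 2 + 1 + t - g)%N by lia.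
  rewrite -(ltn_add2r g) {}E3 {}E1 {}E2 rt; clear; nia.
have [b Hb] := fin_all_exists (fun a => closed_expr_root (x a) r_gt0).
pose H (a : A) y := pmon s (pole_nth a.2) y * pmon s (pole_nth a.1) y ^+ r.
have [|||a0 [xa0 M0]] := @Lead_comb s A H
    (fun a => pole_nth a.2 + r * pole_nth a.1)%N b.
(* The order attached to [a.2] is below [r], so division by [r] recovers both orders. Distinctness
   keeps the auxiliary function from vanishing identically. *)
- move=> [i j] [i' j'] /= E.
  have /andP[_ jr] := pole_nthP j; have /andP[_ jr'] := pole_nthP j'.
  have Ej : pole_nth j = pole_nth j'.
    rewrite -(modn_small jr) -(modn_small jr') -(modnMDl (pole_nth i) (pole_nth j)).
    rewrite -(modnMDl (pole_nth i') (pole_nth j')) !(mulnC _ r) ![(r * _ + _)%N]addnC.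
    by rewrite E.
  move: E; rewrite Ej => /addnI /eqP; rewrite eqn_pmul2l // => /eqP /pole_nth_inj ->.
  by rewrite (pole_nth_inj Ej).
- move=> [i j]; have /andP[Gi im] := pole_nthP i; have /andP[Gj jr] := pole_nthP j.
  exact: Lead_mul (Lead_bas Gj) (Lead_exp r (Lead_bas Gi)).
- exists a; apply: contraNneq xa => b0; rewrite -Hb b0 expr0n.
  by rewrite eqn0Ngt r_gt0.
apply: leq_trans (size_zeros M0 uS _) _ => [y /HS[Cy sy Fy]|].
  split=> //; have : (\sum_a b a * H a y) ^+ r = 0.
    rewrite frob_sum // -[RHS](xz y Cy); apply: eq_bigr => a' _.
    rewrite /H !exprMn Hb -exprM -r2; congr (_ * (_ * _)).
    by rewrite -(pmon_frob _ Fy).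
  by move/eqP; rewrite expf_eq0 => /andP[_ /eqP ->]; rewrite mulr0.
(* The pole order is at most [(r - 1) + r * (m - 1)], which is less than [r^2 + (2 * g + 1) * r]. *)
have /andP[_ jr] := pole_nthP a0.2; have /andP[_ im] := pole_nthP a0.1.
rewrite r2; move: jr im; rewrite /m; clear; nia.
Qed.

End Tower.

(** * Divisor sums of the arithmetic functions *)

Section Irreducible.
Variable F : fieldType.
Implicit Types (P f g d : {poly F}).

Lemma irreducible_divisor f : (1 < size f)%N ->
  exists P, [/\ P \is monic, irreducible_poly P & P %| f].
Proof.
have [n] := ubnP (size f); elim: n f => // n IH f sf f1.
case: (excluded_middle_informative
  (exists g, [&& (1 < size g)%N, (size g < size f)%N & g %| f])).
  case=> g /and3P[g1 gf dgf]; have [|P [mP iP dP]] := IH g _ g1; first by lia.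
  by exists P; split=> //; apply: dvdp_trans dgf.
move=> nex; have f0 : f != 0 by rewrite -size_poly_gt0; lia.
have l0 : (lead_coef f)^-1 != 0 by rewrite invr_eq0 lead_coef_eq0.
exists ((lead_coef f)^-1 *: f); split; last by rewrite dvdpZl.
  by rewrite monicE lead_coefZ mulVf // lead_coef_eq0.
split=> [|g g1]; first by rewrite size_scale.
rewrite dvdpZr // => dg; rewrite (eqp_rtrans (eqp_scale _ l0)).
rewrite -dvdp_size_eqp // eqn_leq dvdp_leq //= leqNgt; apply/negP => lt.
have g0 : g != 0 by apply: contraNneq f0 => g0; rewrite -dvd0p -g0.
by apply: nex; exists g; rewrite lt dg ltn_neqAle eq_sym g1 size_poly_gt0 g0.
Qed.

Lemma irreducible_dvdM P f g : irreducible_poly P ->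
  (P %| f * g) = (P %| f) || (P %| g).
Proof.
move=> iP; case: (boolP (P %| f)) => [/dvdp_mulr -> //|nPf].
by rewrite Gauss_dvdpr // irreducible_poly_coprime.
Qed.

Lemma irreducible_ndvd1 P : irreducible_poly P -> ~~ (P %| 1).
Proof. by case=> P1 _; rewrite dvdp1; lia. Qed.

Lemma irreducible_dvdX P f k : irreducible_poly P -> P %| f ^+ k -> P %| f.
Proof.
move=> iP; elim: k => [|k IH]; first by rewrite expr0 (negbTE (irreducible_ndvd1 iP)).
by rewrite exprS irreducible_dvdM // => /orP[].
Qed.

Lemma irreducible_dvd_eqp P Q : irreducible_poly P -> irreducible_poly Q ->
  P %| Q -> P %= Q.
Proof.
by move=> [P1 _] [_ HQ]; apply: HQ; rewrite neq_ltn P1 orbT.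
Qed.

Lemma irreducible_dvd_prod P (s : seq {poly F}) : P \is monic -> irreducible_poly P ->
  (forall Q, Q \in s -> Q \is monic /\ irreducible_poly Q) ->
  P %| \prod_(Q <- s) Q -> P \in s.
Proof.
move=> mP iP; elim: s => [|Q s IH] Hs.
  by rewrite big_nil (negbTE (irreducible_ndvd1 iP)).
rewrite big_cons irreducible_dvdM // inE => /orP[dQ|dP]; last first.
  by rewrite IH ?orbT // => R Rs; apply: Hs; rewrite inE Rs orbT.
have [mQ iQ] := Hs Q (mem_head _ _).
by rewrite -eqp_monic // irreducible_dvd_eqp.
Qed.

Lemma split_power P f : irreducible_poly P -> f != 0 ->
  exists a g, [/\ f = P ^+ a * g, ~~ (P %| g) & P %| f -> (0 < a)%N].
Proof.
move=> iP; have [n] := ubnP (size f); elim: n f => // n IH f sf f0.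
have [/dvdpP[h fE]|nPf] := boolP (P %| f); last first.
  by exists 0%N, f; rewrite expr0 mul1r.
have h0 : h != 0 by apply: contraNneq f0 => h0; rewrite fE h0 mul0r.
have P1 : (1 < size P)%N by case: iP.
have P0 : P != 0 by rewrite -size_poly_gt0; lia.
have [|//|a [g [hE nPg _]]] := IH h.
  by move: sf; rewrite fE size_mul // ltnS; move: (size P) P1 (size h) => a P1 b; lia.
by exists a.+1, g; split=> //; rewrite fE hE exprSr; ring.
Qed.

End Irreducible.

Section Arithmetic.
Variable F : finFieldType.
Implicit Types (P f g d : {poly F}).

(** The chosen value is unique: if [P ^+ k = Q ^+ l] then [P] and [Q] divide each other and have the
    same size. *)
Lemma vonMangoldtE f (n : nat) : is_prime_power_of f n -> vonMangoldt f = n.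
Proof.
move=> Hd; rewrite /vonMangoldt; case: excluded_middle_informative => [H|[]]; last first.
  by exists n.
case: (constructive_indefinite_description _ H) => n' /= Hn'.
case: Hn' Hd => P [k [iP [k0 [fP ->]]]] [Q [l [iQ [l0 [fQ ->]]]]].
suff /eqp_size -> : Q %= P by [].
apply: irreducible_dvd_eqp => //; apply: (@irreducible_dvdX _ _ _ k) => //.
by rewrite -fP fQ; apply: dvdp_exp.
Qed.

Lemma vonMangoldtX P k : irreducible_poly P -> (0 < k)%N ->
  vonMangoldt (P ^+ k) = (size P).-1.
Proof. by move=> iP k0; apply: vonMangoldtE; exists P, k. Qed.

Lemma vonMangoldt_neq0 f : f \is monic -> vonMangoldt f != 0%N ->
  exists P k, [/\ P \is monic, irreducible_poly P, (0 < k)%N & f = P ^+ k].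
Proof.
move=> mf; rewrite /vonMangoldt.
case: excluded_middle_informative => [[d [P [k [iP [k0 [fP _]]]]]] _|//].
have P0 : P != 0 by apply: irredp_neq0.
have l0 : (lead_coef P)^-1 != 0 by rewrite invr_eq0 lead_coef_eq0.
have mP : (lead_coef P)^-1 *: P \is monic.
  by rewrite monicE lead_coefZ mulVf // lead_coef_eq0.
exists ((lead_coef P)^-1 *: P), k; split=> //.
  split=> [|g g1]; first by rewrite size_scale //; case: iP.
  rewrite dvdpZr // => dg; rewrite (eqp_rtrans (eqp_scale _ l0)).
  by case: iP => _; apply.
rewrite exprZn -fP; have := mf; rewrite fP monicE lead_coef_exp => /eqP E.
by rewrite exprVn E invr1 scale1r.
Qed.

Lemma vonMangoldt1 : vonMangoldt (1 : {poly F}) = 0%N.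
Proof.
apply/eqP; apply: contraT => /(vonMangoldt_neq0 (monic1 _))[P [k [_ iP k0 E]]].
by move: (irreducible_ndvd1 iP); rewrite E dvdp_exp.
Qed.

Lemma vonMangoldt_le f : f \is monic -> (vonMangoldt f <= (size f).-1)%N.
Proof.
move=> mf; have [->//|] := eqVneq (vonMangoldt f) 0%N.
move=> /(vonMangoldt_neq0 mf)[P [k [mP iP k0 fE]]].
rewrite fE vonMangoldtX // size_exp.
by rewrite -[X in (X <= _)%N]muln1 leq_mul.
Qed.

Lemma sqfree_factorization_unique f s s' :
  sqfree_factorization f s -> sqfree_factorization f s' -> size s = size s'.
Proof.
have sub t t' : sqfree_factorization f t -> sqfree_factorization f t' ->
    {subset t <= t'}.
  move=> [f0 [Ht [ut fE]]] [_ [Ht' [ut' fE']]] P Pt.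
  have [mP iP] := Ht P Pt; apply: irreducible_dvd_prod => //.
  rewrite -(dvdpZr _ _ (_ : lead_coef f != 0)) ?lead_coef_eq0 // -fE' fE.
  by rewrite dvdpZr ?lead_coef_eq0 // (big_rem P) //= dvdp_mulr.
move=> Hs Hs'; apply: perm_size; apply: uniq_perm.
- by case: Hs => _ [_ []].
- by case: Hs' => _ [_ []].
by move=> P; apply/idP/idP; apply: sub.
Qed.

Lemma moebiusE f s : sqfree_factorization f s -> moebius f = (-1) ^+ size s.
Proof.
move=> Hs; rewrite /moebius; case: excluded_middle_informative => [H|[]]; last first.
  by exists s.
case: (constructive_indefinite_description _ H) => s' /= Hs'.
by rewrite (sqfree_factorization_unique Hs' Hs).
Qed.

Lemma moebius_eq0 f : ~ (exists s, sqfree_factorization f s) -> moebius f = 0.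
Proof. by move=> H; rewrite /moebius; case: excluded_middle_informative. Qed.

Lemma moebius1 : moebius (1 : {poly F}) = 1.
Proof.
rewrite (@moebiusE _ [::]) //; split; first exact: oner_neq0.
by rewrite big_nil lead_coef1 scale1r.
Qed.

Lemma moebiusM P f : P \is monic -> irreducible_poly P -> f \is monic ->
  ~~ (P %| f) -> moebius (P * f) = - moebius f.
Proof.
move=> mP iP mf nPf; have mPf : P * f \is monic by rewrite rpredM.
have f0 := monic_neq0 mf; have Pf0 := monic_neq0 mPf; have P0 := monic_neq0 mP.
case: (excluded_middle_informative (exists s, sqfree_factorization f s)) => [[s Hs]|nf].
  rewrite (moebiusE Hs) (@moebiusE _ (P :: s)); first by rewrite exprS mulN1r.
  case: Hs => _ [Hs [us fE]]; split=> //; split; last split.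
  - by move=> Q; rewrite inE => /orP[/eqP ->|/Hs].
  - rewrite /= us andbT; apply: contra nPf => Ps.
    by rewrite fE dvdpZr ?lead_coef_eq0 // (big_rem P) //= dvdp_mulr.
  - rewrite big_cons (eqP (mPf : lead_coef _ == 1)) scale1r.
    by rewrite {1}fE (eqP (mf : lead_coef _ == 1)) scale1r.
rewrite (moebius_eq0 nf) oppr0 moebius_eq0 // => -[s [_ [Hs [us fE]]]]; apply: nf.
rewrite (eqP (mPf : lead_coef _ == 1)) scale1r in fE.
have Ps : P \in s by apply: irreducible_dvd_prod => //; rewrite -fE dvdp_mulr.
exists (rem P s); split=> //; split; last split.
- by move=> Q /mem_rem /Hs.
- exact: rem_uniq.
- rewrite (eqP (mf : lead_coef _ == 1)) scale1r.
  by apply: (mulfI P0); rewrite fE (big_rem P).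
Qed.

Lemma moebius_sqr P f : irreducible_poly P -> P \is monic -> P ^+ 2 %| f ->
  moebius f = 0.
Proof.
move=> iP mP d; apply: moebius_eq0 => -[s [f0 [Hs [us fE]]]].
have P0 := monic_neq0 mP.
have Ps : P \in s.
  apply: irreducible_dvd_prod => //.
  rewrite -(dvdpZr _ _ (_ : lead_coef f != 0)) ?lead_coef_eq0 // -fE.
  by apply: dvdp_trans d; apply: dvdp_exp.
move: d; rewrite fE dvdpZr ?lead_coef_eq0 // (big_rem P) //= expr2 dvdp_mul2l //.
move/irreducible_dvd_prod => /(_ mP iP) H.
have : P \in rem P s by apply: H => Q /mem_rem /Hs.
by rewrite mem_rem_uniq // inE eqxx.
Qed.

Lemma moebius_norm f : `|moebius f| <= 1.
Proof.
case: (excluded_middle_informative (exists s, sqfree_factorization f s)) => [[s Hs]|nf].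
  by rewrite (moebiusE Hs) normrX normrN1 expr1n.
by rewrite moebius_eq0 // normr0.
Qed.

Definition monics k : seq {poly F} := [seq 'X^k + val g | g : {poly_k F}].

Lemma mem_monics k f : (f \in monics k) = (f \is monic) && (size f == k.+1).
Proof.
apply/imageP/andP => [[g _ ->]|[mf /eqP sf]].
  have sg := size_npoly g; split.
    by rewrite monicE lead_coefDl ?lead_coefXn // size_polyXn ltnS.
  by rewrite size_polyDl ?size_polyXn // ltnS.
have s1 : (size (f - 'X^k)%R <= k)%N.
  apply/leq_sizeP => j kj; rewrite coefB coefXn.
  move: kj; rewrite leq_eqVlt => /orP[/eqP <-|kj].
    by have := mf; rewrite monicE lead_coefE sf eqxx => /eqP ->; rewrite subrr.
  by rewrite nth_default ?sf // gtn_eqF // subr0.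
by exists (npolyp k (f - 'X^k)) => //; rewrite /= npolypK // addrC subrK.
Qed.

Lemma monics_uniq k : uniq (monics k).
Proof. by apply/injectiveP => g h /addrI /val_inj. Qed.

Lemma size_monics k : size (monics k) = (#|F| ^ k)%N.
Proof. by rewrite size_image card_npoly. Qed.

Lemma monics0 : monics 0 = [:: 1].
Proof.
have := size_monics 0; have := mem_monics 0; case: (monics 0) => [|f [|//]] // H _.
have := H f; rewrite inE eqxx => /esym /andP[mf sf].
by have := size_poly_eq1 f; rewrite sf eqp_monic ?monic1 // => /esym /eqP ->.
Qed.

Lemma monics_dvd k j d : (j <= k)%N -> d \in monics j ->
  perm_eq [seq d * e | e <- monics (k - j)] [seq f <- monics k | d %| f].
Proof.
rewrite mem_monics => jk /andP[md /eqP sd]; have d0 := monic_neq0 md.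
apply: uniq_perm; first by rewrite map_inj_uniq ?monics_uniq //; exact: mulfI.
  by rewrite filter_uniq ?monics_uniq.
move=> f; rewrite mem_filter mem_monics; apply/mapP/andP.
  case=> e; rewrite mem_monics => /andP[me /eqP se] ->.
  rewrite dvdp_mulr // rpredM // size_mul // ?monic_neq0 // sd se.
  by rewrite addSn /= addnS subnKC.
case=> /dvdpP[e fE] /andP[mf /eqP sf]; exists e; last by rewrite fE mulrC.
have me : e \is monic by rewrite -(monicMr _ md) -fE.
rewrite mem_monics me /=.
have e0 : (0 < size e)%N by rewrite size_poly_gt0 monic_neq0.
have := size_mul (monic_neq0 me) d0; rewrite -fE sf sd; move: (size e) e0 => n.
by move=> n0 E; apply/eqP; lia.
Qed.

Section DivisorSums.
Variable R : comNzRingType.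
Implicit Types (u v : {poly F} -> R).

(** For [f] of degree [k] this is the full divisor sum. Grouping by degree matches it with the
    product of two generating series. *)
Definition divsum k u f := \sum_(j < k.+1) \sum_(d <- monics j | d %| f) u d.

(** In terms of L-series: the series of [u * chi] times that of [chi] is the series of the divisor
    sum of [u], twisted by [chi], because [f = d * e] gives [chi f = chi d * chi e]. *)
Lemma convolution k u chi : (forall d e, d \is monic -> e \is monic ->
    chi (d * e) = chi d * chi e) ->
  \sum_(j < k.+1) (\sum_(d <- monics j) u d * chi d) *
      (\sum_(e <- monics (k - j)) chi e) =
  \sum_(f <- monics k) divsum k u f * chi f.
Proof.
move=> chiM; under [RHS]eq_bigr => f _ do rewrite /divsum mulr_suml.
rewrite [RHS]exchange_big /=; apply: eq_bigr => j _.
under [RHS]eq_bigr => f _ do rewrite mulr_suml big_mkcond.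
rewrite [RHS]exchange_big mulr_suml /= big_seq [RHS]big_seq.
apply: eq_bigr => d dj; have jk : (j <= k)%N by rewrite -ltnS.
rewrite -big_mkcond -[RHS]big_filter -(perm_big _ (monics_dvd jk dj)).
rewrite [RHS]big_map mulr_sumr; apply: eq_big_seq => e.
move: dj; rewrite !mem_monics => /andP[md _] /andP[me _].
by rewrite chiM // mulrA.
Qed.

Definition is_divisor_list f (D : seq {poly F}) :=
  uniq D /\ forall d, (d \in D) = (d \is monic) && (d %| f).

Lemma divisor_list_exists f : f != 0 -> exists D, is_divisor_list f D.
Proof.
move=> f0; exists [seq d <- [seq val g | g : {poly_(size f) F}] | (d \is monic) && (d %| f)].
split; first by rewrite filter_uniq //; apply/injectiveP; exact: val_inj.
move=> d; rewrite mem_filter.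
have [/andP[md dd]|//] := boolP ((d \is monic) && (d %| f)); apply/imageP.
by exists (npolyp (size f) d) => //; rewrite /= npolypK // dvdp_leq.
Qed.

Lemma divsumE k u f D : f \in monics k -> is_divisor_list f D ->
  divsum k u f = \sum_(d <- D) u d.
Proof.
rewrite mem_monics => /andP[mf /eqP sf] [uD memD].
rewrite (partition_big (fun d => inord (size d).-1 : 'I_k.+1) predT) //=.
apply: eq_bigr => j _; rewrite -[LHS]big_filter -[RHS]big_filter; apply: perm_big.
apply: uniq_perm; rewrite ?filter_uniq ?monics_uniq // => d.
rewrite !mem_filter memD mem_monics andbC -!andbA andbC.
have [md|] := boolP (d \is monic); last by rewrite !(andbF, andFb).
have [dd|] := boolP (d %| f); last by rewrite !(andbF, andFb).
have sd : (size d <= k.+1)%N by rewrite -sf dvdp_leq ?monic_neq0.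
have d0 : (0 < size d)%N by rewrite size_poly_gt0 monic_neq0.
rewrite -val_eqE /=; move: (size d) sd d0 => [//|n] sd _ /=.
by rewrite inordK // !andbT /= eqSS.
Qed.

Lemma divisor_list_split P a g Dg : P \is monic -> irreducible_poly P ->
    ~~ (P %| g) -> is_divisor_list g Dg ->
  is_divisor_list (P ^+ a * g) [seq P ^+ i * d | i <- iota 0 a.+1, d <- Dg].
Proof.
move=> mP iP nPg [uD memD]; have P0 := monic_neq0 mP.
have nPd d : d %| g -> ~~ (P %| d).
  by move=> dg; apply: contra nPg => Pd; apply: dvdp_trans dg.
have cop d i : ~~ (P %| d) -> coprimep (P ^+ i) d.
  by move=> nd; rewrite coprimep_expl // irreducible_poly_coprime.
split.
  apply: allpairs_uniq; rewrite ?iota_uniq // => -[i d] [i' d'].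
  move=> /allpairsP[[i1 d1] [_ + [-> ->]]] /allpairsP[[i2 d2] [_ + [-> ->]]] /=.
  rewrite /= !memD => /andP[_ /nPd n1] /andP[_ /nPd n2] E.
  wlog le : i1 i2 d1 d2 n1 n2 E / (i1 <= i2)%N.
    have [le H|/ltnW le H] := leqP i1 i2; first exact: H.
    by rewrite (H i2 i1 d2 d1).
  move: E; rewrite -{1}(subnKC le) exprD -mulrA => /(mulfI (expf_neq0 _ P0)) E.
  have [i0|i_gt0] := posnP (i2 - i1).
    by move: E; rewrite i0 expr0 mul1r => ->; congr pair; lia.
  by move: n1; rewrite E dvdp_mulr // dvdp_exp.
move=> d; apply/allpairsP/andP.
  case=> p []; rewrite mem_iota memD; case: p => i e /= ia /andP[me eg] ->.
  by rewrite rpredM ?rpredX // dvdp_mul // dvdp_exp2l.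
case=> md dd; have [i [e [dE nPe _]]] := split_power iP (monic_neq0 md).
exists (i, e); rewrite mem_iota memD [(i, e).1]/= [(i, e).2]/= -dE; split=> //.
  have : P ^+ i %| P ^+ a.
    rewrite -(Gauss_dvdpl _ (cop g i nPg)); apply: dvdp_trans dd.
    by rewrite dE dvdp_mulr.
  move/dvdp_leq; rewrite expf_neq0 // => /(_ isT).
  move=> le; have P1 : (0 < (size P).-1)%N by case: iP => + _; case: (size P) => [|[]].
  by rewrite /= add0n ltnS -(leq_pmul2l P1) -!size_exp -!subn1 leq_sub2r.
rewrite -(monicMr _ (_ : P ^+ i \is monic)) ?rpredX // mulrC -dE md /=.
have : e %| P ^+ a * g by apply: dvdp_trans dd; rewrite dE dvdp_mull.
by rewrite Gauss_dvdpr // coprimep_sym cop.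
Qed.

(** For [f = P ^+ a * g] with [g] prime to [P], the divisors [d] and [P * d] with [d %| g] cancel in
    pairs, and those divisible by [P ^+ 2] contribute zero. *)
Lemma divsum_moebius k f : f \in monics k ->
  divsum k (fun d => (moebius d)%:~R) f = (k == 0%N)%:R.
Proof.
case: k => [|k] fk.
  move: fk; rewrite monics0 inE => /eqP ->.
  by rewrite /divsum big_ord1 monics0 big_mkcond big_seq1 dvdpp moebius1.
have := fk; rewrite mem_monics => /andP[mf /eqP sf].
have [|P [mP iP Pf]] := @irreducible_divisor _ f; first by rewrite sf.
have [a [g [fE nPg /(_ Pf) a0]]] := split_power iP (monic_neq0 mf).
have g0 : g != 0 by apply: contraNneq nPg => ->; rewrite dvdp0.
have [D HD] := divisor_list_exists g0.
have fD := divisor_list_split a mP iP nPg HD; rewrite -fE in fD.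
rewrite (divsumE _ fk fD) big_allpairs_dep; case: a a0 {fE fD} => // a _.
rewrite !big_cons /= expr0 expr1 big_seq [X in _ + (_ + X)]big_seq.
rewrite [X in _ + (_ + X)]big1 ?addr0 => [|i].
  rewrite [X in _ + X]big_seq -big_split big1 //= => d.
  case: HD => _ ->; move=> /andP[md dg].
  by rewrite mul1r moebiusM ?rmorphN ?subrr // (contra (fun h => dvdp_trans h dg)).
rewrite mem_iota => /andP[i2 _]; rewrite big1 // => d _.
by rewrite (@moebius_sqr P) // dvdp_mulr // dvdp_exp2l.
Qed.

(** For [f = P ^+ a * g] with [g] prime to [P], the divisors of [g] give its degree by induction.
    Among the others only [P, ..., P ^+ a] are prime powers, and each gives the degree of [P]. *)
Lemma divsum_vonMangoldt k f : f \in monics k ->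
  divsum k (fun d => (vonMangoldt d)%:R) f = k%:R.
Proof.
elim/ltn_ind: k f => -[_|k IH] f fk.
  move: fk; rewrite monics0 inE => /eqP ->.
  by rewrite /divsum big_ord1 monics0 big_mkcond big_seq1 dvdpp vonMangoldt1.
have := fk; rewrite mem_monics => /andP[mf /eqP sf].
have [|P [mP iP Pf]] := @irreducible_divisor _ f; first by rewrite sf.
have [a [g [fE nPg /(_ Pf) a0]]] := split_power iP (monic_neq0 mf).
have g0 : g != 0 by apply: contraNneq nPg => ->; rewrite dvdp0.
have P1 : (1 < size P)%N by case: iP.
have mg : g \is monic by rewrite -(monicMr _ (_ : P ^+ a \is monic)) ?rpredX // mulrC -fE.
have [D HD] := divisor_list_exists g0.
have fD := divisor_list_split a mP iP nPg HD; rewrite -fE in fD.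
have sg : k.+1 = ((size P).-1 * a + (size g).-1)%N.
  have := size_mul (expf_neq0 a (monic_neq0 mP)) g0; rewrite -fE sf => E.
  move: E (size_exp P a) g0 (expf_neq0 a (monic_neq0 mP)); rewrite -!size_poly_gt0.
  by move: (size (P ^+ a)) (size g) ((size P).-1 * a)%N => u v w; lia.
rewrite (divsumE _ fk fD) big_allpairs_dep big_cons /= expr0.
under eq_bigr => d _ do rewrite mul1r.
rewrite -(@divsumE (size g).-1 _ g) //; last first.
  by rewrite mem_monics mg prednK ?size_poly_gt0 ?eqxx.
rewrite IH; last first.
- by rewrite mem_monics mg prednK ?size_poly_gt0 ?eqxx.
- have : (0 < (size P).-1 * a)%N by rewrite muln_gt0 a0; lia.
  by rewrite sg; lia.
rewrite sg natrD addrC; congr (_ + _).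
transitivity (\sum_(1 <= i < a.+1) (size P).-1%:R : R); last first.
  by rewrite sumr_const_nat subSS subn0 mulrnA.
rewrite /index_iota subSS subn0 big_seq [RHS]big_seq; apply: eq_bigr => i.
rewrite mem_iota => /andP[i0 _]; case: HD => uD memD.
have D1 : 1 \in D by rewrite memD monic1 dvd1p.
rewrite (big_rem 1) //= mulr1 vonMangoldtX // big_seq big1 ?addr0 // => d.
rewrite mem_rem_uniq // inE /= memD => /andP[d1 /andP[md dg]].
have [->//|] := eqVneq (vonMangoldt (P ^+ i * d)) 0%N.
have mPd : P ^+ i * d \is monic by rewrite rpredM ?rpredX.
case/(vonMangoldt_neq0 mPd) => Q [l [mQ iQ l0 QE]].
have PQ : P = Q.
  apply/eqP; rewrite -eqp_monic //; apply: irreducible_dvd_eqp => //.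
  by apply: (@irreducible_dvdX _ _ _ l) => //; rewrite -QE dvdp_mulr // dvdp_exp.
case/negP: d1; rewrite -eqp_monic ?monic1 // /eqp dvd1p andbT.
have : d %| P ^+ l by rewrite PQ -QE dvdp_mull.
have cP : coprimep (P ^+ l) d.
  rewrite coprimep_expl // irreducible_poly_coprime //.
  by apply: contra nPg => h; apply: dvdp_trans dg.
by rewrite -(mulr1 (P ^+ l)) Gauss_dvdpr // coprimep_sym.
Qed.

End DivisorSums.

End Arithmetic.

(** * Points on the curve and prime powers in a class *)

Section Reverse.
Variable R : idomainType.
Implicit Types (f g : {poly R}).

Definition revp f := \poly_(j < size f) f`_((size f).-1 - j).

Lemma coef_revp f n j : size f = n.+1 ->
  (revp f)`_j = if (j <= n)%N then f`_(n - j) else 0.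
Proof. by move=> sf; rewrite coef_poly sf ltnS. Qed.

Lemma coef0_revp f : f \is monic -> (revp f)`_0 = 1.
Proof.
move=> mf; have f0 : (0 < size f)%N by rewrite size_poly_gt0 monic_neq0.
have sf : size f = (size f).-1.+1 by rewrite prednK.
by rewrite (coef_revp _ sf) leq0n subn0 -lead_coefE; apply/monicP.
Qed.

Lemma revp_mulXsubC f a : f \is monic ->
  revp (('X - a%:P) * f) = (1 - a *: 'X) * revp f.
Proof.
move=> mf; have f0 : (0 < size f)%N by rewrite size_poly_gt0 monic_neq0.
have [n sf] : exists n, size f = n.+1 by exists (size f).-1; rewrite prednK.
have sXf : size (('X - a%:P) * f) = n.+2.
  by rewrite size_monicM ?monicXsubC ?monic_neq0 // size_XsubC sf.
apply/polyP => j; rewrite (coef_revp _ sXf) !mulrBl !coefB mul1r coefXM coefCM.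
rewrite -scalerAl coefZ coefXM !(coef_revp _ sf).
have fn : f`_n.+1 = 0 by rewrite nth_default ?sf.
case: j => [|j] /=; first by rewrite !subn0 fn !mulr0 !subr0.
rewrite ltnS subSS; have [jn|nj|->] := ltngtP j n.
- by rewrite subn_eq0 leqNgt jn /= subnS.
- by rewrite mulr0 subr0.
- by rewrite subnn.
Qed.

Lemma revp1 : revp 1 = 1.
Proof. by apply/polyP => -[|j]; rewrite coef_poly size_poly1 //= !coef1. Qed.

Lemma revp_prod_XsubC (I : Type) (r : seq I) (a : I -> R) :
  revp (\prod_(i <- r) ('X - (a i)%:P)) = \prod_(i <- r) (1 - a i *: 'X).
Proof.
elim: r => [|i r IH]; first by rewrite !big_nil revp1.
by rewrite !big_cons revp_mulXsubC ?monic_prod_XsubC ?IH.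
Qed.

End Reverse.

Lemma revp_map (F K : fieldType) (h : {rmorphism F -> K}) (f : {poly F}) :
  revp (map_poly h f) = map_poly h (revp f).
Proof.
apply/polyP => i; rewrite coef_map [LHS]coef_poly [in RHS]coef_poly size_map_poly coef_map.
by case: ifP => // _; apply/esym; exact: rmorph0.
Qed.

Section Points.
Variables (F : finFieldType) (K : closedFieldType) (iota : {rmorphism F -> K}).
Local Notation q := #|F|.
Local Notation "f ^%" := (map_poly iota f) (at level 2, format "f ^%").
Implicit Types (P f g : {poly F}) (t : K).

Lemma card_gt1 : (1 < q)%N.
Proof. exact: card_finNzRing_gt1. Qed.

Lemma card_pchar : [pchar K].-nat q.
Proof.
have [p p_pr pF] := finPcharP F.
rewrite (card_pprimeChar pF) pnatX pnatE //.
by rewrite (fmorph_pchar iota) pF.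
Qed.

Lemma expf_card_iter (x : F) m : x ^+ (q ^ m) = x.
Proof. by elim: m => [|m IH]; rewrite ?expr1 // expnSr exprM IH expf_card. Qed.

Lemma horner_frob f t m : f^%.[t ^+ (q ^ m)] = f^%.[t] ^+ (q ^ m).
Proof.
rewrite !horner_coef frob_sum ?pnatX ?card_pchar //.
apply: eq_bigr => i _; rewrite exprMn -!exprM mulnC; congr (_ * _).
by rewrite coef_map -rmorphXn expf_card_iter.
Qed.

Lemma pow_card_inj m : injective (fun x : K => x ^+ (q ^ m)).
Proof.
move=> x y /= E; apply/eqP; rewrite -subr_eq0.
have pm : [pchar K].-nat (q ^ m)%N by rewrite pnatX card_pchar.
have : (x - y) ^+ (q ^ m) = 0.
  by apply: (addIr (y ^+ (q ^ m))); rewrite add0r -exprDn_pchar // subrK.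
by move/eqP; rewrite expf_eq0 => /andP[].
Qed.

(** * Conjugates of a root of an irreducible polynomial *)

Section Root.
Variables (P : {poly F}) (t : K).
Hypotheses (mP : P \is monic) (iP : irreducible_poly P) (Pt : root P^% t).
Let d := (size P).-1.

Lemma root_irreducible f : root f^% t = (P %| f).
Proof.
apply/idP/idP => [ft|/dvdpP[g ->]]; last first.
  by rewrite rmorphM rootE hornerM (eqP Pt) mulr0.
have [//|nPf] := boolP (P %| f).
have : coprimep P^% f^% by rewrite coprimep_map irreducible_poly_coprime.
by move/coprimep_root => /(_ _ Pt) /negP[]; exact: ft.
Qed.

(** The residue ring modulo [P] is a field with [q ^ d] elements, so [P] divides [X^(q^d) - X]. *)
Lemma root_frob_degree : t ^+ (q ^ d) = t.
Proof.
have hI : monic_irreducible_poly P by split.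
have := expf_card (in_qpoly P 'X : {poly %/ P with hI}).
rewrite card_qfpoly -/d => E.
have {}E : in_qpoly P ('X ^+ (q ^ d) - 'X) = 0.
  have E' : (in_qpoly P 'X : {poly %/ P}) ^+ (q ^ d) = in_qpoly P 'X := E.
  by rewrite rmorphB rmorphXn /= E' subrr.
suff : P %| 'X^(q ^ d) - 'X.
  by rewrite -root_irreducible rmorphB /= map_polyXn map_polyX rootE !hornerE subr_eq0 => /eqP.
move/val_eqP: E => /=; rewrite -Pdiv.IdomainMonic.modpE ?mk_monicE //.
Qed.

(** The [q ^ d] values at [t] of the polynomials of degree less than [d] are distinct, and all are
    roots of [X^(q^m) - X] once [t] is. *)
Lemma root_frob_minimal m : (0 < m)%N -> t ^+ (q ^ m) = t -> (d <= m)%N.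
Proof.
move=> m0 tm; pose g (u : {poly_d F}) := (val u)^%.[t].
have gI : injective g.
  move=> u v E; apply/val_inj/eqP; rewrite -subr_eq0.
  have : P %| val u - val v.
    by rewrite -root_irreducible rmorphB rootE hornerD hornerN subr_eq0; apply/eqP.
  apply: contraTT => /dvdp_leq H; apply/negP => /H; rewrite leqNgt; case/negP.
  have d1 : (0 < size P)%N by rewrite size_poly_gt0 monic_neq0.
  rewrite -(prednK d1) ltnS (leq_trans (size_polyD _ _)) // size_polyN geq_max.
  by rewrite !size_npoly.
have qm1 : (1 < q ^ m)%N by rewrite -(expn0 q) ltn_exp2l ?card_gt1.
pose N : {poly K} := 'X^(q ^ m) - 'X.
have sN : size N = (q ^ m).+1.
  by rewrite size_polyDl ?size_polyXn // size_polyN size_polyX ltnS.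
have N0 : N != 0 by rewrite -size_poly_gt0 sN.
have := @max_poly_roots _ N [seq g u | u : {poly_d F}] N0.
rewrite sN ltnS size_image card_npoly => H.
rewrite -(leq_exp2l _ _ card_gt1); apply: H; last exact/injectiveP.
apply/allP => _ /imageP[u _ ->].
by rewrite rootE !hornerE subr_eq0 /g -horner_frob tm.
Qed.

Definition orbit := [seq t ^+ (q ^ i) | i : 'I_d <- index_enum 'I_d].

Lemma size_orbit : size orbit = d.
Proof. by rewrite size_map /index_enum -enumT size_enum_ord. Qed.

Lemma orbit_root : all (root P^%) orbit.
Proof.
apply/allP => _ /mapP[i _ ->]; rewrite rootE horner_frob (eqP Pt).
by rewrite expr0n eqn0Ngt expn_gt0 (ltnW card_gt1).
Qed.

Lemma orbit_uniq : uniq orbit.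
Proof.
rewrite map_inj_uniq ?index_enum_uniq // => i j E.
wlog le : i j E / (i <= j)%N.
  by move=> H; have [/H->|/ltnW/H->] := leqP i j.
have [ij|ji] := leqP j i; first by apply: val_inj => /=; lia.
have : t ^+ (q ^ (j - i)) = t.
  by apply: (@pow_card_inj i); rewrite -exprM -expnD subnK.
by move/root_frob_minimal; rewrite subn_gt0 => /(_ ji); have := ltn_ord j; lia.
Qed.

Lemma root_frob_prod : P^% = \prod_(i < d) ('X - (t ^+ (q ^ i))%:P).
Proof.
have d1 : (0 < size P)%N by rewrite size_poly_gt0 monic_neq0.
rewrite (@all_roots_prod_XsubC K P^% orbit) ?orbit_root ?uniq_rootsE ?orbit_uniq //.
  by rewrite lead_coef_map (eqP mP) rmorph1 scale1r big_map.
by rewrite size_map_poly size_orbit prednK.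
Qed.

(** The conjugates of [t] recur with period [d], so the product runs [e] times through the roots of
    [P]. *)
Lemma root_frob_prodX e :
  (P ^+ e)^% = \prod_(0 <= i < d * e) ('X - (t ^+ (q ^ i))%:P).
Proof.
elim: e => [|e IH]; first by rewrite muln0 expr0 rmorph1 big_geq.
rewrite exprSr rmorphM /= IH mulnS addnC [RHS](@big_cat_nat _ _ _ (d * e)) ?leq_addr //=.
congr (_ * _); rewrite root_frob_prod -{1}[(d * e)%N]add0n big_addn addKn big_mkord.
apply: eq_bigr => i _; congr ('X - _%:P).
elim: e {IH} => [|e IH]; first by rewrite muln0 addn0.
by rewrite mulnS addnCA expnD exprM root_frob_degree.
Qed.

End Root.

(** The von Mangoldt function counts the elements of the field with [q ^ n] elements whose
    characteristic polynomial is [f]: for a power of [P] these are the roots of [P]. *)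
Lemma vonMangoldt_roots n f : f \in monics F n -> exists R : seq K,
  [/\ uniq R, size R = vonMangoldt f &
      forall t, t \in R -> f^% = \prod_(0 <= i < n) ('X - (t ^+ (q ^ i))%:P)].
Proof.
rewrite mem_monics => /andP[mf /eqP sf].
have [->|] := eqVneq (vonMangoldt f) 0%N; first by exists [::].
case/(vonMangoldt_neq0 mf) => P [k [mP iP k0 fE]].
have [|t Pt] := closed_rootP P^% _.
  by rewrite size_map_poly; case: iP => + _; case: (size P) => [|[]].
exists (orbit P t); split.
- exact: orbit_uniq.
- by rewrite size_orbit fE vonMangoldtX.
move=> t' /(allP (orbit_root Pt)) Pt'.
rewrite fE (root_frob_prodX mP iP Pt').
by rewrite -size_exp -fE sf.
Qed.

Lemma vonMangoldt_points n (L : seq {poly F}) : uniq L -> {subset L <= monics F n} ->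
  exists T : seq K, [/\ uniq T, size T = \sum_(f <- L) vonMangoldt f &
    forall t, t \in T -> exists2 f, f \in L &
      f^% = \prod_(0 <= i < n) ('X - (t ^+ (q ^ i))%:P)].
Proof.
elim: L => [|f L IH] /=; first by exists [::]; rewrite big_nil.
move=> /andP[fL uL] sub; have [|T [uT sT HT]] := IH uL.
  by move=> g gL; apply: sub; rewrite inE gL orbT.
have [R [uR sR HR]] := vonMangoldt_roots (sub f (mem_head _ _)).
exists (R ++ T); split; last 1 first.
- move=> t; rewrite mem_cat => /orP[/HR E|/HT[g gL E]].
    by exists f; rewrite ?mem_head.
  by exists g; rewrite // inE gL orbT.
- rewrite cat_uniq uR uT andbT; apply/hasPn => t /HT[g gL E].
  apply: contra fL => /HR; rewrite -E => /map_poly_inj ->.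
  exact: gL.
- by rewrite size_cat sR sT big_cons.
Qed.

(** Each of the [s.+1] coordinates solves an Artin-Schreier equation over the earlier ones, with [q]
    solutions. *)
Lemma curve_points s (t : K) : exists Y : seq {poly K},
  [/\ uniq Y, size Y = (q ^ s.+1)%N & forall y, y \in Y ->
    [/\ curve q s y, (size y <= s.+2)%N & y`_1 - y`_1 ^+ q = t]].
Proof.
have [rt Hrt] : exists rt : K -> seq K, forall a, [/\ uniq (rt a), size (rt a) = q &
    forall x, (x \in rt a) = (x ^+ q == x + a)].
  exists (fun a => proj1_sig (constructive_indefinite_description _
    (artin_schreier_roots card_gt1 card_pchar a))) => a.
  by case: (constructive_indefinite_description _ _).
elim: s => [|s [Y [uY sY HY]]].
  have [ur sr Hr] := Hrt (- t); exists [seq 1 + a *: 'X | a <- rt (- t)].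
  have c1 a : (1 + a *: 'X : {poly K})`_1 = a.
    by rewrite coefD coef1 coefZ coefX mulr1 add0r.
  split; last move=> _ /mapP[a + ->].
  - rewrite map_inj_uniq // => a b /(congr1 (fun p : {poly K} => p`_1)).
    by rewrite !c1.
  - by rewrite size_map sr expn1.
  rewrite Hr => /eqP Ha; split.
  - split; first by rewrite coefD coef1 coefZ coefX mulr0 addr0.
    by move=> j; lia.
  - rewrite (leq_trans (size_polyD _ _)) // geq_max size_poly1 /=.
    by rewrite (leq_trans (size_scale_leq _ _)) // size_polyX.
  - by rewrite c1 Ha; ring.
pose next (y : {poly K}) := rt ((y`_1 ^+ q - y`_1) * y`_s.+1).
exists [seq y + a *: 'X^(s.+2) | y <- Y, a <- next y].
have top y : y \in Y -> y`_s.+2 = 0.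
  by case/HY => _ sy _; rewrite nth_default.
have co y (a : K) j : (y + a *: 'X^(s.+2))`_j = y`_j + (if j == s.+2 then a else 0).
  rewrite coefD coefZ coefXn; case: eqP => _; rewrite ?mulr1 ?mulr0 //.
split; last 1 first.
- move=> _ /allpairsPdep[y [a [yY + ->]]].
  have [_ _ ->] := Hrt ((y`_1 ^+ q - y`_1) * y`_s.+1) => /eqP Ha.
  have [Cy sy ty] := HY y yY; split.
  + by have := curve_update card_gt1 card_pchar Cy Ha; rewrite top // subr0.
  + rewrite (leq_trans (size_polyD _ _)) // geq_max (leq_trans sy) //=.
    by rewrite (leq_trans (size_scale_leq _ _)) // size_polyXn.
  + by rewrite !co /= addr0.
- apply: allpairs_uniq_dep => //.
    by move=> y _; have [] := Hrt ((y`_1 ^+ q - y`_1) * y`_s.+1).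
  move=> _ _ /allpairsPdep[y [a [yY _ ->]]] /allpairsPdep[z [b [zY _ ->]]] /= E.
  have coE j := congr1 (fun p : {poly K} => p`_j) E.
  have ab : a = b by have := coE s.+2; rewrite !co eqxx !top // !add0r.
  by move: E; rewrite ab => /addIr ->.
rewrite size_allpairs_dep (eq_map (g := fun=> q)); last first.
  by move=> y; have [] := Hrt ((y`_1 ^+ q - y`_1) * y`_s.+1).
rewrite expnS -sY mulnC; elim: (Y) => //= y Y' ->; rewrite mulSn //.
Qed.

(** This iterates [y^(q) = (1 - t T) y]. The resulting factor is the reverse of the product of all
    [X - t^(q^i)], which links the points to the class of a characteristic polynomial. *)
Lemma curve_frob s (y : {poly K}) (t : K) m j : curve q s y ->
  y`_1 - y`_1 ^+ q = t -> (j <= s.+1)%N ->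
  (\prod_(0 <= i < m) (1 - t ^+ (q ^ i) *: 'X) * y)`_j = y`_j ^+ (q ^ m).
Proof.
move=> [y0 Cy] ty; elim: m j => [|m IH] j js.
  by rewrite big_geq // mul1r expr1.
rewrite big_nat_recr //= (mulrC (\prod_(_ <= _ < _) _)) -mulrA mulrBl mul1r coefB.
rewrite -scalerAl coefZ coefXM IH //.
case: j js => [|j] js /=; first by rewrite y0 !expr1n mulr0 subr0.
rewrite IH ?(ltnW js) // expnS exprM.
have -> : y`_j.+1 ^+ (q ^ m) = (y`_j.+1 ^+ q + t * y`_j) ^+ (q ^ m).
  congr (_ ^+ _); case: j js => [|j] js; first by rewrite y0 -ty; ring.
  by rewrite Cy // -ty; ring.
by rewrite exprDn_pchar ?pnatX ?card_pchar // exprMn addrK.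
Qed.

Definition in_class s (c f : {poly F}) := [forall j : 'I_s.+2, (revp f)`_j == c`_j].

(** Each [f] in the class yields [vonMangoldt f] elements [t], each with [q ^ s.+1] points above it,
    and [curve_frob] shows these points to be fixed by the Frobenius twisted by [c]. *)
Theorem vonMangoldt_class_bound s : exists B r0, forall k (c : {poly F}),
  (r0 <= q ^ k)%N -> c`_0 = 1 ->
  ((\sum_(f <- monics F (2 * k) | in_class s c f)
      vonMangoldt f) * q ^ s.+1 <= q ^ (2 * k) + B * q ^ k)%N.
Proof.
have [B [r0 bound]] := frobenius_fixed_bound card_gt1 card_pchar s.
exists B, r0 => k c r_big c0.
pose L := [seq f <- monics F (2 * k) | in_class s c f].
have [||T [uT sT HT]] := @vonMangoldt_points (2 * k) L.
- by rewrite filter_uniq // monics_uniq.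
- by move=> f; rewrite mem_filter => /andP[].
rewrite -big_filter -/L -sT.
have [S [uS sS HS]] : exists S : seq {poly K}, [/\ uniq S,
    size S = (size T * q ^ s.+1)%N & forall y, y \in S -> exists2 t, t \in T &
    [/\ curve q s y, (size y <= s.+2)%N & y`_1 - y`_1 ^+ q = t]].
  elim: (T) uT => [|t T' IH] /=; first by exists [::].
  move=> /andP[tT' /IH[S [uS sS HS]]]; have [Y [uY sY HY]] := curve_points s t.
  exists (Y ++ S); split; last 1 first.
  - move=> y; rewrite mem_cat => /orP[/HY Hy|/HS[t' t'T Hy]].
      by exists t; rewrite ?mem_head.
    by exists t'; rewrite // inE t'T orbT.
  - rewrite cat_uniq uY uS andbT; apply/hasPn => y /HS[t' t'T [_ _ yt']].
    by apply: contra tT' => /HY[_ _ <-]; rewrite yt'.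
  - by rewrite size_cat sY sS mulSn.
rewrite -sS; apply: (bound k c^%) => //.
- by rewrite coef_map c0; exact: rmorph1.
- by move=> j; rewrite coef_map -rmorphXn expf_card.
move=> y /HS[t /HT[f fL fE] [Cy sy ty]]; split=> // j /andP[_ js].
rewrite -(curve_frob _ Cy ty js) -revp_prod_XsubC -fE.
rewrite revp_map !coefM; apply: eq_bigr => i _; rewrite !coef_map; congr (_ * _).
move: fL; rewrite mem_filter => /andP[/forallP H _].
have is2 : (i < s.+2)%N by have := ltn_ord i; lia.
by rewrite (eqP (H (Ordinal is2))).
Qed.

End Points.

(** * Inverse roots of the L-function *)

Section PowerSums.
Implicit Types (l : seq algC) (a b : algC).

Definition eulerp l : {poly algC} := \prod_(x <- l) (1 - x *: 'X).

Lemma coef_mul1subX (p : {poly algC}) a k :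
  ((1 - a *: 'X) * p)`_k = p`_k - (if k is k'.+1 then a * p`_k' else 0).
Proof.
rewrite mulrBl mul1r coefB -scalerAl coefZ coefXM.
by case: k => [|k] //=; rewrite mulr0.
Qed.

(** Logarithmic derivative: [- E' / E] is the generating series of the power sums. It is cut off at
    order [K], and the multiple of ['X^K] absorbs the tail. *)
Lemma newton_poly l K : exists h,
  (eulerp l)^`() + (\poly_(j < K) \sum_(x <- l) x ^+ j.+1) * eulerp l = 'X^K * h.
Proof.
elim: l => [|a l [h IH]].
  exists 0; rewrite /eulerp big_nil -polyC1 derivC add0r mulr1 mulr0.
  by apply/polyP => j; rewrite coef_poly big_nil if_same coef0.
pose G : {poly algC} := \poly_(j < K) a ^+ j.+1.
have HG : (1 - a *: 'X) * G = a%:P - a ^+ K.+1 *: 'X^K.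
  apply/polyP => k; rewrite coef_mul1subX coefB coefC coefZ coefXn !coef_poly.
  case: k => [|k] /=.
    clear h IH; rewrite expr1; case: K @G => [|K] /=; first by rewrite subr0 expr1 mulr1 subrr.
    by rewrite mulr0.
  rewrite coef_poly; have [lt|gt|->] := ltngtP k.+1 K.
  - by rewrite mulr0 -exprS subrr subr0.
  - by rewrite !mulr0 !subr0.
  - by rewrite mulr1 -exprS.
exists ((1 - a *: 'X) * h - a ^+ K.+1 *: eulerp l).
have -> : \poly_(j < K) (\sum_(x <- a :: l) x ^+ j.+1) =
    G + \poly_(j < K) \sum_(x <- l) x ^+ j.+1.
  apply/polyP => j; rewrite coefD !coef_poly; case: ifP => _; last by rewrite addr0.
  by rewrite big_cons.
rewrite {1 2}/eulerp big_cons -/(eulerp l) derivM derivB derivC derivZ derivX.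
set P := \poly_(j < K) \sum_(x <- l) x ^+ j.+1 in IH *; set E := eulerp l in IH *.
have -> : (0 - a *: 1) * E + (1 - a *: 'X) * E^`() + (G + P) * ((1 - a *: 'X) * E)
  = ((1 - a *: 'X) * G - a *: 1) * E + (1 - a *: 'X) * (E^`() + P * E) by ring.
by rewrite IH HG alg_polyC -!mul_polyC; ring.
Qed.

Lemma newton l k : (eulerp l)`_k.+1 *+ k.+1 =
  - \sum_(j < k.+1) (\sum_(x <- l) x ^+ j.+1) * (eulerp l)`_(k - j).
Proof.
have [h] := newton_poly l k.+1.
move/(congr1 (fun p : {poly algC} => p`_k)); rewrite coefD coef_deriv coefXnM ltnSn.
move/eqP; rewrite addr_eq0 => /eqP ->; congr (- _); rewrite coefM.
by apply: eq_bigr => j _; rewrite coef_poly ltn_ord.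
Qed.

(** Up to order [K], [M] is the inverse of [eulerp l]. Dividing by one factor [1 - a T] at a time
    sums at most [k.+1] earlier bounds, which costs a factor [k.+1] each time. *)
Lemma inverse_coef_bound l (B : algC) K (M : {poly algC}) :
    (forall x, x \in l -> `|x| <= B) -> 0 <= B ->
    (forall k, (k < K)%N -> (M * eulerp l)`_k = (k == 0%N)%:R) ->
  forall k, (k < K)%N -> `|M`_k| <= (k.+1 ^ size l)%:R * B ^+ k.
Proof.
move=> + B0; elim: l M => [|a l IH] M Hl HM k kK.
  have := HM k kK; rewrite /eulerp big_nil mulr1 => ->; rewrite expn0 mul1r.
  by case: k {kK} => [|k]; rewrite ?normr1 ?normr0 // exprn_ge0.
have aB : `|a| <= B by apply: Hl; rewrite mem_head.
pose M2 := (1 - a *: 'X) * M.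
have HM2 j : (j < K)%N -> `|M2`_j| <= (j.+1 ^ size l)%:R * B ^+ j.
  apply: IH => [x xl|i iK]; first by apply: Hl; rewrite inE xl orbT.
  by rewrite -(HM i iK) /M2 /eulerp big_cons mulrAC mulrC.
elim: k kK => [|k IHk] kK.
  by have := HM2 0%N kK; rewrite /M2 coef_mul1subX subr0 !exp1n.
have -> : M`_k.+1 = M2`_k.+1 + a * M`_k by rewrite coef_mul1subX subrK.
rewrite (le_trans (ler_normD _ _)) // /= expnS mulSn natrD mulrDl lerD ?HM2 //.
rewrite normrM exprS.
have := ler_pM (normr_ge0 a) (normr_ge0 M`_k) aB (IHk (ltnW kK)).
move/le_trans; apply; rewrite [X in _ <= X]mulrCA ler_wpM2l // ler_wpM2r ?exprn_ge0 //.
by rewrite ler_nat /= expnS leq_mul //; case: (size l) => // e; rewrite leq_exp2r.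
Qed.

(** If [y > 1], Bernoulli's inequality makes the powers grow at least linearly, against the
    Archimedean property. *)
Lemma bounded_powers (y C : algC) k0 : 0 <= y ->
  (forall k, (k0 <= k)%N -> y ^+ k <= C) -> y <= 1.
Proof.
move=> y0 H; rewrite real_leNgt ?ger0_real ?ler01 //; apply/negP => y1.
have e0 : 0 < y - 1 by rewrite subr_gt0.
have bern k : 1 + k%:R * (y - 1) <= y ^+ k.
  elim: k => [|k IH]; first by rewrite mul0r addr0 expr0.
  rewrite exprS; apply: le_trans (ler_wpM2l y0 IH).
  rewrite -natr1 -subr_ge0.
  have -> : y * (1 + k%:R * (y - 1)) - (1 + (k%:R + 1) * (y - 1)) =
    k%:R * (y - 1) ^+ 2 by ring.
  by rewrite mulr_ge0 // exprn_ge0 // ltW.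
have C0 : 0 <= C by apply: le_trans (H k0 (leqnn _)); rewrite exprn_ge0.
have z0 : 0 <= C / (y - 1) by rewrite divr_ge0 // ltW.
have := archi_boundP z0; set N := Num.bound _ => HN.
rewrite ltr_pdivrMr // in HN.
have h := le_trans (bern (k0 + N)%N) (H _ (leq_addr _ _)).
have h2 : N%:R * (y - 1) <= 1 + (k0 + N)%:R * (y - 1).
  by rewrite natrD mulrDl addrA lerDr addr_ge0 // mulr_ge0 // ltW.
by have := lt_le_trans HN (le_trans h2 h); rewrite ltxx.
Qed.

(** [P] vanishes at the other entries of [l] but not at [x]. Combining consecutive power sums with
    its coefficients isolates [x ^+ k], up to the constant [P.[x]] and the multiplicity of [x], a
    positive integer. *)
Lemma power_sum_bound l (Q C : algC) k0 : 0 < Q ->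
  (forall k, (k0 <= k)%N -> `|\sum_(x <- l) x ^+ k| <= C * Q ^+ k) ->
  forall x, x \in l -> `|x| <= Q.
Proof.
move=> Q0 H x xl.
pose P : {poly algC} := \prod_(z <- rem x (undup l)) ('X - z%:P).
have Px : P.[x] != 0.
  by rewrite -rootE root_prod_XsubC mem_rem_uniq ?undup_uniq // inE eqxx.
have Pz z : z \in l -> z != x -> P.[z] = 0.
  move=> zl zx; apply/eqP; rewrite -rootE root_prod_XsubC.
  by rewrite mem_rem_uniq ?undup_uniq // inE zx mem_undup.
pose D := \sum_(i < size P) `|P`_i| * (C * Q ^+ i).
have key k : (k0 <= k)%N -> `|P.[x]| * `|x| ^+ k <= D * Q ^+ k.
  move=> kk; have E : \sum_(z <- l) P.[z] * z ^+ k = (P.[x] * x ^+ k) *+ count_mem x l.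
    rewrite (bigID (pred1 x)) /= [X in _ + X]big_seq_cond [X in _ + X]big1 ?addr0; last first.
      by move=> z /andP[zl zx]; rewrite Pz // mul0r.
    rewrite (eq_bigr (fun=> P.[x] * x ^+ k)) => [|z /eqP -> //].
    by rewrite big_const_seq iter_addr_0.
  have E2 : \sum_(z <- l) P.[z] * z ^+ k =
      \sum_(i < size P) P`_i * \sum_(z <- l) z ^+ (k + i).
    under eq_bigr => z _ do rewrite horner_coef mulr_suml.
    rewrite exchange_big; apply: eq_bigr => i _ /=.
    by rewrite mulr_sumr; apply: eq_bigr => z _; rewrite addnC exprD mulrA.
  apply: (@le_trans _ _ `|(P.[x] * x ^+ k) *+ count_mem x l|).
    rewrite normrMn -normrX -normrM -[X in X <= _]mulr1n ler_wpMn2l //.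
    by rewrite -has_count has_pred1.
  rewrite -E E2 (le_trans (ler_norm_sum _ _ _)) // /D mulr_suml ler_sum // => i _.
  rewrite normrM -!mulrA ler_wpM2l // -exprD addnC H //.
  exact: leq_trans kk (leq_addl _ _).
suff : `|x| / Q <= 1 by rewrite ler_pdivrMr // mul1r.
apply: (@bounded_powers _ (D / `|P.[x]|) k0) => [|k kk].
  by rewrite divr_ge0 // ltW.
have P0 : 0 < `|P.[x]| by rewrite normr_gt0.
rewrite ler_pdivlMr // expr_div_n mulrC mulrA ler_pdivrMr ?exprn_gt0 //.
exact: key.
Qed.

End PowerSums.

Section LPolynomial.
Variables (a psi mob : nat -> algC) (S q : nat).
Hypotheses (q_gt0 : (0 < q)%N) (a0 : a 0%N = 1) (aS : forall k, (S < k)%N -> a k = 0).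
Hypothesis psi0 : psi 0%N = 0.
Hypothesis psi_a : forall k, \sum_(j < k.+1) psi j * a (k - j)%N = k%:R * a k.
Hypothesis mob_a : forall k, \sum_(j < k.+1) mob j * a (k - j)%N = (k == 0%N)%:R.
Variables (C : algC) (k0 : nat).
Hypothesis psi_even : forall k, (k0 <= k)%N -> `|psi (2 * k)%N| <= C * q%:R ^+ k.

(** [a], [psi] and [mob] stand for the coefficients of an L-function [L], of [T L' / L] and of
    [1 / L]. The reverse of [L] in degree [S] is monic as [a 0 = 1]; its roots form [l], with zeros
    among them if [L] has smaller degree. *)
Lemma inverse_roots : exists l, size l = S /\ forall k, a k = (eulerp l)`_k.
Proof.
pose P : {poly algC} := \poly_(i < S.+1) a (S - i)%N.
have PS : P`_S = 1 by rewrite coef_poly ltnSn subnn a0.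
have sP : size P = S.+1.
  apply/eqP; rewrite eqn_leq size_poly /= ltnNge; apply/negP => /leq_sizeP/(_ S (leqnn _)).
  by rewrite PS => /eqP; rewrite oner_eq0.
have mP : lead_coef P = 1 by rewrite lead_coefE sP PS.
have [l Pl] := closed_field_poly_normal P; rewrite mP scale1r in Pl.
exists l; split; first by apply/eqP; rewrite -eqSS -sP Pl size_prod_XsubC.
move=> k; rewrite /eulerp -revp_prod_XsubC -Pl (coef_revp _ sP).
have [kS|Sk] := leqP k S; last exact: aS.
by rewrite coef_poly ltnS leq_subr subKn.
Qed.

(** By Newton's identities [psi] is minus the power sum of the inverse roots. In even degrees this
    is a power sum of their squares, whence [|x|^2 <= q]. The constant [C] and the threshold [k0]
    disappear, as only the growth rate determines the size of the roots. *)
Theorem riemann_bound n :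
  `|psi n.+1| <= S%:R * sqrtC q%:R ^+ n.+1 /\
  `|mob n| <= (n.+1 ^ S)%:R * sqrtC q%:R ^+ n.
Proof.
have [l [sl al]] := inverse_roots.
have psiE k : psi k.+1 = - \sum_(x <- l) x ^+ k.+1.
  elim/ltn_ind: k => k IH.
  have := psi_a k.+1; rewrite big_ord_recl psi0 mul0r add0r mulr_natl al newton.
  rewrite !big_ord_recr /= subnn -al a0 !mulr1 opprD => E.
  apply: (addrI (\sum_(i < k) psi i.+1 * a (k - i)%N)).
  have {}E : \sum_(i < k) psi i.+1 * a (k - i)%N + psi k.+1 * a (k - k)%N =
    - (\sum_(i < k) (\sum_(x <- l) x ^+ i.+1) * (eulerp l)`_(k - i))
    - \sum_(x <- l) x ^+ k.+1 := E.
  rewrite subnn a0 mulr1 in E; rewrite E; congr (_ + _); rewrite -sumrN; apply: eq_bigr => i _.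
  by rewrite IH // al mulNr.
have q0 : (0 : algC) < q%:R by rewrite ltr0n.
have lB x : x \in l -> `|x| <= sqrtC q%:R.
  move=> xl; rewrite -(@ler_pXn2r _ 2) ?nnegrE ?sqrtC_ge0 ?(ltW q0) // sqrtCK.
  have xl2 : x ^+ 2 \in [seq z ^+ 2 | z <- l] by apply: map_f.
  (* The threshold [k0.+1] excludes the exponent 0, about which [psiE] says nothing. *)
  rewrite -normrX; apply: (@power_sum_bound _ q%:R C k0.+1 q0 _ _ xl2) => -[//|k] kk.
  rewrite big_map; under eq_bigr => z _ do rewrite -exprM.
  rewrite -normrN mulnS -(psiE (1 + 2 * k)%N).
  by have := psi_even (ltnW kk); rewrite mulnS.
have B0 : 0 <= sqrtC q%:R :> algC by rewrite sqrtC_ge0 ltW.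
split.
  rewrite psiE normrN (le_trans (ler_norm_sum _ _ _)) //.
  apply: (@le_trans _ _ (\sum_(x <- l) sqrtC q%:R ^+ n.+1)).
    rewrite big_seq [X in _ <= X]big_seq ler_sum // => x xl.
    by rewrite normrX lerXn2r ?nnegrE ?lB.
  by rewrite big_const_seq count_predT iter_addr_0 sl mulr_natl.
pose M : {poly algC} := \poly_(j < n.+1) mob j.
have -> : mob n = M`_n by rewrite coef_poly ltnSn.
rewrite -sl; apply: (@inverse_coef_bound l _ n.+1) => // k kn.
rewrite coefM -mob_a; apply: eq_bigr => j _; rewrite -al coef_poly.
by rewrite (leq_trans (ltn_ord j)).
Qed.

End LPolynomial.

(** * The group of classes *)

Section Parseval.
Variables (gT : finGroupType) (G : {group gT}).
Hypothesis cG : abelian G.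

(** On an abelian group every function is a class function, and each of the [#|G|] irreducible
    characters contributes at most [M / #|G|^2] to the norm. *)
Lemma parseval_bound (W : gT -> algC) M :
  (forall i : Iirr G, `|\sum_(x in G) W x * ('chi_i x)^*| ^+ 2 <= M) ->
  \sum_(x in G) `|W x| ^+ 2 <= M.
Proof.
move=> H; pose f x := if x \in G then W x else 0.
have f_class : is_class_fun G [ffun x => f x].
  apply: intro_class_fun => [x y xG yG|x /negbTE xG]; last by rewrite /f xG.
  by rewrite /f groupJ // xG conjgE (centsP cG x xG y yG) mulKg.
have cl : is_class_fun <<G>>%g [ffun x => f x] by rewrite genGid.
pose phi : 'CF(G) := Cfun 0 cl.
have phiE x : x \in G -> phi x = W x by move=> xG; rewrite cfunElock /f xG.
have G0 : 0 < (#|G|%:R : algC) by rewrite ltr0n cardG_gt0.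
have E1 : '[phi] = #|G|%:R^-1 * \sum_(x in G) `|W x| ^+ 2.
  rewrite cfdotE; congr (_ * _); apply: eq_bigr => x xG.
  by rewrite phiE // normCK.
have E2 : '[phi] <= M / #|G|%:R.
  rewrite cfdot_sum_irr.
  apply: (@le_trans _ _ (\sum_(i : Iirr G) M / #|G|%:R ^+ 2)).
    apply: ler_sum => i _; rewrite -normCK cfdotE normrM normfV exprMn exprVn.
    rewrite normr_nat mulrC ler_wpM2r ?invr_ge0 ?exprn_ge0 ?ler0n //.
    apply: le_trans (H i); rewrite (eq_bigr (fun x => W x * ('chi_i x)^*)) //.
    by move=> x xG; rewrite phiE.
  rewrite sumr_const card_Iirr_abelian // -mulr_natr.
  by rewrite le_eqVlt; apply/orP; left; apply/eqP; field; rewrite gt_eqF.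
move: E2; rewrite E1 mulrC ler_pM2r ?invr_gt0 //.
Qed.

End Parseval.

(** Over an algebraic closure both factors split, and the reverse of a product of linear factors is
    explicit. *)
Lemma revpM (F : finFieldType) (f g : {poly F}) : f \is monic -> g \is monic ->
  revp (f * g) = revp f * revp g.
Proof.
move=> mf mg; have [K [h _]] := countable_algebraic_closure F.
apply: (map_poly_inj h); rewrite rmorphM /= -!revp_map rmorphM /=.
have split (r : {poly F}) : r \is monic ->
    exists l, map_poly h r = \prod_(x <- l) ('X - (x : K)%:P).
  move=> mr; have [l E] := closed_field_poly_normal (map_poly h r).
  by exists l; rewrite {1}E lead_coef_map (monicP mr) rmorph1 scale1r.
have [l1 ->] := split f mf; have [l2 ->] := split g mg.
by rewrite -big_cat !revp_prod_XsubC big_cat.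
Qed.

Section ClassGroup.
Variables (F : finFieldType) (s : nat).
Local Notation q := #|F|.
Local Notation N := s.+2.
Local Notation Rq := {poly %/ ('X^N : {poly F})}.
Local Notation gT := {unit Rq}.

Definition tcoef (x : gT) j : F := (polyn (FinRing.uval x) : {poly F})`_j.

Lemma tcoef_inj (x y : gT) : (forall j, (j < N)%N -> tcoef x j = tcoef y j) -> x = y.
Proof.
move=> H; apply/val_inj/val_inj/polyP => j /=.
have [jN|Nj] := ltnP j N; first exact: H.
have sz (z : gT) : (size (polyn (FinRing.uval z)) <= N)%N.
  by rewrite (leq_trans (size_npoly _)) // mk_monic_Xn size_polyXn.
by rewrite !nth_default // (leq_trans (sz _)).
Qed.

Lemma coef_in_qpolyXn (p : {poly F}) j : (j < N)%N ->
  (polyn (in_qpoly 'X^N p))`_j = p`_j.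
Proof.
move=> jN; rewrite /= mk_monic_Xn -Pdiv.RingMonic.take_poly_rmodp coef_take_poly jN //.
Qed.

Lemma in_qpoly_unit (p : {poly F}) :
  p`_0 = 1 -> (in_qpoly 'X^N p : Rq) \is a GRing.unit.
Proof.
move=> p0; apply/unitrPr; exists (qpoly_inv (in_qpoly 'X^N p)).
have cX (r : {poly F}) : r`_0 = 1 -> coprimep 'X r.
  move=> r0; rewrite -['X]subr0 coprimep_sym -polyC0 coprimep_XsubC rootE.
  by rewrite horner_coef0 r0 oner_eq0.
rewrite mulrC qpoly_mulVz // {1}mk_monic_Xn coprimep_expl // cX //.
by rewrite coef_in_qpolyXn // p0.
Qed.

(** The default [1%g] concerns only non-units modulo ['X^N]; the polynomials of interest have
    constant coefficient 1. *)
Definition cls (p : {poly F}) : gT := insubd (1%g : gT) (in_qpoly 'X^N p : Rq).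

Lemma val_cls (p : {poly F}) : p`_0 = 1 -> val (cls p) = in_qpoly 'X^N p.
Proof. by move=> p0; rewrite insubdK //; apply: in_qpoly_unit. Qed.

Lemma tcoef_cls (p : {poly F}) j : p`_0 = 1 -> (j < N)%N -> tcoef (cls p) j = p`_j.
Proof.
by move=> p0 jN; rewrite /tcoef -[FinRing.uval _]/(val _) val_cls // coef_in_qpolyXn.
Qed.

Lemma clsM (p r : {poly F}) : p`_0 = 1 -> r`_0 = 1 -> cls (p * r) = (cls p * cls r)%g.
Proof.
move=> p0 r0; have pr0 : (p * r)`_0 = 1 by rewrite coefM big_ord1 p0 r0 mulr1.
by apply: val_inj; rewrite /= -![FinRing.uval _]/(val _) !val_cls // rmorphM.
Qed.

Definition class_set : {set gT} := [set x | tcoef x 0 == 1].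

Lemma cls_in (p : {poly F}) : p`_0 = 1 -> cls p \in class_set.
Proof. by move=> p0; rewrite inE tcoef_cls // p0. Qed.

Lemma clsK x : x \in class_set -> cls (polyn (FinRing.uval x)) = x.
Proof.
rewrite inE => /eqP x0; apply: tcoef_inj => j jN.
by rewrite tcoef_cls.
Qed.

Lemma class_group_set : group_set class_set.
Proof.
apply/group_setP; split; first by rewrite inE /tcoef /= coefC eqxx.
move=> x y xG yG; rewrite -(clsK xG) -(clsK yG) -clsM; last 2 first.
- by move: xG; rewrite inE => /eqP.
- by move: yG; rewrite inE => /eqP.
apply: cls_in; rewrite coefM big_ord1.
by move: xG yG; rewrite !inE => /eqP x0 /eqP y0; rewrite -!/(tcoef _ 0) x0 y0 mulr1.
Qed.
Canonical class_group := Group class_group_set.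

Lemma class_abelian : abelian class_group.
Proof.
apply/centsP => x _ y _; apply: val_inj => /=.
exact: mulrC.
Qed.

Lemma card_class_group : #|class_group| = (q ^ s.+1)%N.
Proof.
pose e (g : {poly_(s.+1) F}) : {poly F} := 1 + 'X * val g.
have e0 g : (e g)`_0 = 1 by rewrite coefD coef1 coefXM addr0.
have eS g j : (e g)`_j.+1 = (val g)`_j by rewrite coefD coef1 coefXM add0r.
rewrite -card_npoly -[RHS]cardsT.
have -> : class_group = [set cls (e g) | g in [set: {poly_(s.+1) F}]] :> {set gT}.
  apply/setP => x; apply/idP/imsetP => [xG|[g _ ->]]; last exact: cls_in.
  exists (npolyp s.+1 (\poly_(j < s.+1) tcoef x j.+1)) => //.
  apply: tcoef_inj => -[|j] jN; rewrite tcoef_cls ?e0 ?eS //.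
    by move: xG; rewrite inE => /eqP.
  by rewrite coef_npolyp coef_poly -ltnS jN.
rewrite card_imset // => g g' E; apply/npolyP => j.
have [jS|Sj] := ltnP j s.+1; last by rewrite !big_coef_npoly.
by have := congr1 (fun x => tcoef x j.+1) E; rewrite /= !tcoef_cls ?e0 // !eS.
Qed.

Local Notation u f := (cls (revp f)).

Lemma cls_revp_in (f : {poly F}) : f \is monic -> u f \in class_group.
Proof. by move=> mf; apply: cls_in; rewrite coef0_revp. Qed.

Lemma cls_revpM (f g : {poly F}) : f \is monic -> g \is monic -> u (f * g) = (u f * u g)%g.
Proof. by move=> mf mg; rewrite revpM // clsM ?coef0_revp. Qed.

Lemma in_classE (c f : {poly F}) : c`_0 = 1 -> f \is monic -> in_class s c f = (u f == cls c).
Proof.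
move=> c0 mf; have f0 := coef0_revp mf; apply/forallP/eqP => [H|E j].
  by apply: tcoef_inj => j jN; rewrite !tcoef_cls //; apply/eqP/(H (Ordinal jN)).
by have := congr1 (fun x => tcoef x j) E; rewrite /= !tcoef_cls ?ltn_ord // => ->.
Qed.

(** Reversal moves the leading coefficients to the front, so equal classes mean equal coefficients
    from degree [k] down to [k - s.+1]. A class is thus a short interval. *)
Lemma cls_revp_fiber k (f : {poly F}) : (s < k)%N -> f \in monics F k ->
  perm_eq [seq f + val g | g : {poly_(k - s.+1) F}] [seq f' <- monics F k | u f' == u f].
Proof.
move=> sk fk; have := fk; rewrite mem_monics => /andP[mf /eqP sf].
apply: uniq_perm; first by apply/injectiveP => g h /addrI /val_inj.
  by rewrite filter_uniq ?monics_uniq.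
move=> f'; rewrite mem_filter; apply/imageP/andP.
  case=> g _ ->; have sg := size_npoly g.
  have sfg : size (f + val g) = k.+1.
    by rewrite size_polyDl // sf; apply: leq_ltn_trans sg _; lia.
  have mfg : f + val g \is monic.
    by rewrite monicE lead_coefDl ?(eqP mf) // sf; apply: leq_ltn_trans sg _; lia.
  rewrite mem_monics mfg sfg eqxx; split=> //; apply/eqP/tcoef_inj => j jN.
  rewrite !tcoef_cls ?coef0_revp // !(coef_revp _ sf, coef_revp _ sfg).
  case: leqP => // jk; rewrite coefD [X in _ + X]nth_default ?addr0 //.
  by apply: leq_trans sg _; lia.
case=> /eqP E; rewrite mem_monics => /andP[mf' /eqP sf'].
have sd : (size (f' - f)%R <= k - s.+1)%N.
  apply/leq_sizeP => j; rewrite leq_subLR => kj; rewrite coefB.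
  have [jk|kj'] := leqP j k; last by rewrite !nth_default ?subr0 ?sf ?sf'.
  have jN : (k - j < N)%N by lia.
  have := congr1 (fun x => tcoef x (k - j)) E; rewrite /= !tcoef_cls ?coef0_revp //.
  by rewrite (coef_revp _ sf) (coef_revp _ sf') leq_subr subKn // => ->; rewrite subrr.
by exists (npolyp (k - s.+1) (f' - f)) => //; rewrite /= npolypK // addrC subrK.
Qed.

Lemma cls_revp_surj k x : (s < k)%N -> x \in class_group -> exists2 f, f \in monics F k & u f = x.
Proof.
move=> sk; rewrite inE => /eqP x0.
pose f : {poly F} := \poly_(i < k.+1) tcoef x (k - i).
have fk : f`_k = 1 by rewrite coef_poly ltnSn subnn.
have sf : size f = k.+1.
  apply/eqP; rewrite eqn_leq size_poly /= ltnNge; apply/negP => /leq_sizeP/(_ k (leqnn _)).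
  by rewrite fk => /eqP; rewrite oner_eq0.
have mf : f \is monic by rewrite monicE lead_coefE sf fk.
exists f; first by rewrite mem_monics mf sf eqxx.
apply: tcoef_inj => j jN; rewrite tcoef_cls ?coef0_revp // (coef_revp _ sf).
have jk : (j <= k)%N by lia.
by rewrite coef_poly jk ltnS leq_subr subKn.
Qed.

Lemma count_fiber k x : (s < k)%N -> x \in class_group ->
  count (fun f => u f == x) (monics F k) = (q ^ (k - s.+1))%N.
Proof.
move=> sk /(cls_revp_surj sk)[f fk <-]; rewrite -size_filter -(perm_size (cls_revp_fiber sk fk)).
by rewrite size_image card_npoly.
Qed.

Lemma sum_fibers (R : nmodType) k (w : {poly F} -> R) :
  \sum_(f <- monics F k) w f = \sum_(x in class_group) \sum_(f <- monics F k | u f == x) w f.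
Proof.
rewrite big_seq (partition_big (fun f => u f) (mem class_group)) => [|f]; last first.
  by rewrite mem_monics => /andP[mf _]; exact: cls_revp_in.
apply: eq_bigr => x _; rewrite [RHS]big_seq_cond; apply: eq_bigl => f.
by [].
Qed.

Lemma sum_monics_class (R : pzSemiRingType) k (H : gT -> R) : (s < k)%N ->
  \sum_(f <- monics F k) H (u f) = (q ^ (k - s.+1))%:R * \sum_(x in class_group) H x.
Proof.
move=> sk; rewrite sum_fibers mulr_sumr; apply: eq_bigr => x xG.
rewrite (eq_bigr (fun=> H x)) => [|f /eqP -> //].
by rewrite big_const_seq iter_addr_0 count_fiber // mulr_natl.
Qed.

End ClassGroup.

(** * Character sums *)

Section Characters.
Variables (F : finFieldType) (s : nat).
Local Notation q := #|F|.
Local Notation G := (class_group F s).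
Local Notation u f := (cls s (revp f)).
Implicit Types (f g : {poly F}) (i : Iirr G).

Definition chi i f : algC := 'chi_i (u f).
Definition charsum i (w : {poly F} -> algC) k := \sum_(f <- monics F k) w f * chi i f.

Lemma chi_lin i : 'chi_i \is a linear_char.
Proof. exact: (char_abelianP G (class_abelian F s) i). Qed.

Lemma chiM i f g : f \is monic -> g \is monic -> chi i (f * g) = chi i f * chi i g.
Proof. by move=> mf mg; rewrite /chi cls_revpM // lin_charM ?chi_lin ?cls_revp_in. Qed.

Lemma chi1 i : chi i 1 = 1.
Proof.
rewrite /chi; have -> : u (1 : {poly F}) = 1%g.
  have E := cls_revpM s (monic1 F) (monic1 F); rewrite mulr1 in E.
  by have := congr1 (mulg (u (1 : {poly F}))^-1%g) E; rewrite mulVg mulKg => /esym; apply.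
exact: lin_char1 (chi_lin i).
Qed.

Lemma chi0E f : f \is monic -> chi 0 f = 1.
Proof. by move=> mf; rewrite /chi irr0 cfun1E cls_revp_in. Qed.

Lemma sum_irr_eq0 i : i != 0 -> \sum_(x in G) 'chi_i x = 0.
Proof.
move=> i0; have := cfdot_irr i 0; rewrite (negbTE i0) cfdotE => /eqP.
rewrite mulf_eq0 invr_eq0 pnatr_eq0 eqn0Ngt cardG_gt0 /= => /eqP E.
by rewrite -[RHS]E; apply: eq_bigr => x xG; rewrite irr0 cfun1E xG conjC1 mulr1.
Qed.

(** Above degree [s] every class contains equally many monic polynomials, and a nontrivial character
    sums to zero. This makes the L-function a polynomial. *)
Lemma charsum1_eq0 i k : i != 0 -> (s < k)%N -> charsum i (fun=> 1) k = 0.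
Proof.
move=> i0 sk; rewrite /charsum; under eq_bigr => f _ do rewrite mul1r.
by rewrite (sum_monics_class (fun x => 'chi_i x)) // sum_irr_eq0 ?mulr0.
Qed.

Lemma charsum_convolution i w k :
  \sum_(j < k.+1) charsum i w j * charsum i (fun=> 1) (k - j) =
  charsum i (divsum k w) k.
Proof.
rewrite [RHS]/charsum -(convolution k w (@chiM i)); apply: eq_bigr => j _; congr (_ * _).
by apply: eq_bigr => f _; rewrite mul1r.
Qed.

Lemma charsum_vonMangoldt i k :
  \sum_(j < k.+1) charsum i (fun f => (vonMangoldt f)%:R) j * charsum i (fun=> 1) (k - j) =
  k%:R * charsum i (fun=> 1) k.
Proof.
rewrite charsum_convolution mulr_sumr; apply: eq_big_seq => f fk.
by rewrite divsum_vonMangoldt // mul1r.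
Qed.

Lemma charsum_moebius i k :
  \sum_(j < k.+1) charsum i (fun f => (moebius f)%:~R) j * charsum i (fun=> 1) (k - j) =
  (k == 0%N)%:R.
Proof.
rewrite charsum_convolution; case: k => [|k].
  by rewrite /charsum monics0 big_seq1 divsum_moebius ?monics0 ?mem_head // chi1 mulr1.
by rewrite /charsum big_seq big1 // => f fk; rewrite divsum_moebius ?mul0r.
Qed.

Lemma charsum0_1 k : charsum 0 (fun=> 1) k = q%:R ^+ k.
Proof.
rewrite /charsum big_seq (eq_bigr (fun=> 1)) => [|f]; last first.
  by rewrite mem_monics => /andP[mf _]; rewrite chi0E // mulr1.
by rewrite -big_seq big_const_seq count_predT size_monics iter_addr_0 natrX.
Qed.

Lemma charsum_vonMangoldt0 i : charsum i (fun f => (vonMangoldt f)%:R) 0 = 0.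
Proof. by rewrite /charsum monics0 big_seq1 vonMangoldt1 mul0r. Qed.

(** In the convolution identity of degree [k.+1] the [k] earlier terms are each [q ^ k.+1] by
    induction, which leaves the same value for the last. *)
Lemma charsum0_vonMangoldt k :
  charsum 0 (fun f => (vonMangoldt f)%:R) k.+1 = q%:R ^+ k.+1.
Proof.
elim/ltn_ind: k => k IH.
have := charsum_vonMangoldt 0 k.+1.
rewrite big_ord_recl charsum_vonMangoldt0 mul0r add0r big_ord_recr /= subnn.
rewrite !charsum0_1 mulr1 (eq_bigr (fun=> q%:R ^+ k.+1)) => [|j _]; last first.
  rewrite charsum0_1 IH // -exprD; congr (_ ^+ _).
  by have := ltn_ord j; rewrite /bump; lia.
by rewrite sumr_const card_ord -natr1 mulrDl mul1r mulr_natl => /addrI.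
Qed.

(** The inverse of the zeta function is [1 - q T]. Concretely, the identity in degree [k.+2] is
    compared with [q] times that in degree [k.+1]. *)
Lemma charsum0_moebius k : charsum 0 (fun f => (moebius f)%:~R) k.+2 = 0.
Proof.
have := charsum_moebius 0 k.+2; rewrite big_ord_recr /= subnn charsum0_1 mulr1.
rewrite (eq_bigr (fun j : 'I_k.+2 => q%:R * (charsum 0 (fun f => (moebius f)%:~R) j *
  charsum 0 (fun=> 1) (k.+1 - j)))) => [|j _]; last first.
  rewrite !charsum0_1 mulrCA; congr (_ * _); rewrite -exprS; congr (_ ^+ _).
  by have := ltn_ord j; lia.
by rewrite -mulr_sumr charsum_moebius mulr0 add0r.
Qed.

(* As the total over all classes is known, the upper bound in each class is enough. *)
Lemma charsum_vonMangoldt_even : exists (B k0 : nat), forall i k, i != 0 -> (k0 <= k)%N ->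
  `|charsum i (fun f => (vonMangoldt f)%:R) (2 * k)| <= B%:R * q%:R ^+ k.
Proof.
have [K [h _]] := countable_algebraic_closure F.
have [B [r0 bound]] := vonMangoldt_class_bound h s.
exists B, r0.+1 => i k i0 rk.
have k_gt0 : (0 < k)%N by lia.
have rq : (r0 <= q ^ k)%N.
  by apply: leq_trans (ltnW rk) (ltnW (ltn_expl k (card_gt1 F))).
pose Psi x : algC := \sum_(f <- monics F (2 * k) | u f == x) (vonMangoldt f)%:R.
pose U : algC := (q ^ (2 * k) + B * q ^ k)%:R.
have PsiU x : x \in G -> #|G|%:R * Psi x <= U.
  move=> xG; have c0 : (polyn (FinRing.uval x))`_0 = 1.
    by move: (xG); rewrite inE => /eqP.
  have := bound k _ rq c0; rewrite -(ler_nat algC) natrM natr_sum card_class_group.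
  rewrite mulrC; apply: le_trans; rewrite le_eqVlt; apply/orP; left; apply/eqP.
  congr (_ * _); rewrite [LHS]big_seq_cond [RHS]big_seq_cond; apply: eq_bigl => f.
  have [|//] := boolP (f \in monics F (2 * k)); rewrite mem_monics => /andP[mf _].
  by rewrite in_classE // clsK.
have sumPsi : \sum_(x in G) Psi x = q%:R ^+ (2 * k).
  have -> : (2 * k = (2 * k).-1.+1)%N by lia.
  rewrite -charsum0_vonMangoldt /charsum /Psi prednK ?muln_gt0 //.
  rewrite -sum_fibers; apply: eq_big_seq => f.
  by rewrite mem_monics => /andP[mf _]; rewrite chi0E // mulr1.
have G0 : 0 < (#|G|%:R : algC) by rewrite ltr0n cardG_gt0.
rewrite -(ler_pM2l G0) -{1}[#|G|%:R]ger0_norm ?(ltW G0) // -normrM.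
(* The constant [U] may be subtracted because the character sums to zero. All differences then have
   one sign, so their absolute values add up to a known total. *)
have -> : #|G|%:R * charsum i (fun f => (vonMangoldt f)%:R) (2 * k) =
    \sum_(x in G) (#|G|%:R * Psi x - U) * 'chi_i x.
  under [RHS]eq_bigr => x _ do rewrite mulrBl -mulrA.
  rewrite sumrB -!mulr_sumr sum_irr_eq0 // mulr0 subr0; congr (_ * _).
  rewrite /charsum (sum_fibers s); apply: eq_bigr => x xG.
  by rewrite mulr_suml; apply: eq_bigr => f /eqP <-.
apply: (@le_trans _ _ (\sum_(x in G) (U - #|G|%:R * Psi x))).
  apply: le_trans (ler_norm_sum _ _ _) _; apply: ler_sum => x xG.
  rewrite normrM normC_lin_char ?chi_lin // mulr1 distrC ger0_norm //.
  by rewrite subr_ge0 PsiU.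
rewrite sumrB sumr_const -mulr_sumr sumPsi -[U *+ _]mulr_natl -mulrBr.
by rewrite /U natrD natrM !natrX addrAC subrr add0r.
Qed.

Lemma charsum_bound i n : i != 0 ->
  `|charsum i (fun f => (vonMangoldt f)%:R) n.+1| <= s.+1%:R * sqrtC q%:R ^+ n.+1 /\
  `|charsum i (fun f => (moebius f)%:~R) n| <= (n.+1 ^ s.+1)%:R * sqrtC q%:R ^+ n.
Proof.
move=> i0; have [B [k0 HB]] := charsum_vonMangoldt_even.
apply: (@riemann_bound (charsum i (fun=> 1)) _ _ s.+1 q _ _ _ _ _ _ B%:R k0).
- by rewrite (ltnW (card_gt1 F)).
- by rewrite /charsum monics0 big_seq1 chi1 mulr1.
- by move=> k sk; apply: charsum1_eq0 => //; apply: ltnW.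
- exact: charsum_vonMangoldt0.
- exact: charsum_vonMangoldt.
- exact: charsum_moebius.
- by move=> k kk; apply: HB.
Qed.

Lemma class_variance (w : {poly F} -> int) n c :
  (forall i, `|charsum i (fun f => (w f)%:~R) n| ^+ 2 <= (c * q ^ n)%:R) ->
  \sum_(x in G) (\sum_(f <- monics F n | u f == x) w f) ^+ 2 <= (c * q ^ n)%:Z.
Proof.
move=> H; pose W x : algC := \sum_(f <- monics F n | u f == x) (w f)%:~R.
have : \sum_(x in G) `|W x| ^+ 2 <= (c * q ^ n)%:R.
  apply: (@parseval_bound _ _ (class_abelian F s)) => i; apply: le_trans (H i).
  rewrite -norm_conjC rmorph_sum /= /charsum (sum_fibers s).
  rewrite (eq_bigr (fun x => \sum_(f <- monics F n | u f == x) (w f)%:~R * chi i f)) //.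
  move=> x xG; rewrite rmorphM /= conjCK mulrC rmorph_sum mulr_sumr.
  by apply: eq_bigr => f /eqP <-; rewrite /= rmorph_int mulrC.
rewrite -(ler_int algC) rmorph_sum /=; congr (_ <= _).
apply: eq_bigr => x xG; rewrite rmorphXn rmorph_sum /= -/(W x).
have WR : W x \is Num.real by apply: rpred_sum => f _; rewrite realz.
by rewrite real_normK.
Qed.

(** The inner sum depends only on the class of [f], and each class occurs for [q ^ h.+1] polynomials
    [f]; hence the last factor. *)
Lemma interval_variance (w : {poly F} -> int) h c : let n := (s.+1 + h.+1)%N in
  (forall i, `|charsum i (fun f => (w f)%:~R) n| ^+ 2 <= (c * q ^ n)%:R) ->
  \sum_(f <- monics F n) (\sum_(g : {poly_h.+1 F}) w (f + val g)) ^+ 2 <=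
    (c * q ^ n * q ^ h.+1)%:Z.
Proof.
move=> n H; have sn : (s < n)%N by rewrite /n; lia.
have e : (n - s.+1 = h.+1)%N by rewrite addKn.
pose W x := \sum_(f <- monics F n | u f == x) w f.
rewrite (eq_big_seq (fun f => W (u f) ^+ 2)) => [|f fn]; last first.
  have := cls_revp_fiber sn fn; rewrite e => P.
  by congr (_ ^+ _); rewrite /W -[RHS]big_filter -(perm_big _ P) big_image.
rewrite (sum_monics_class (fun x => W x ^+ 2)) // e mulnC PoszM -natz.
by rewrite ler_wpM2l // class_variance.
Qed.

End Characters.

(** * Moments *)

Section Moments.
Variables (F : finFieldType).
Local Notation q := #|F|.

Lemma sqr_le_sqrtC (z : algC) c n : `|z| <= c%:R * sqrtC q%:R ^+ n ->
  `|z| ^+ 2 <= (c ^ 2 * q ^ n)%:R.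
Proof.
move=> H; apply: le_trans (lerXn2r 2 _ _ H) _; rewrite ?nnegrE //.
  by rewrite mulr_ge0 ?ler0n // exprn_ge0 // sqrtC_ge0 ler0n.
by rewrite exprMn exprAC sqrtCK natrM !natrX.
Qed.

(** Subtracting 1 removes the trivial character, for which both sums equal [q ^ n]. It leaves the
    other characters unaffected, as their sums over degree [n > s] vanish. *)
Lemma vonMangoldt_variance s h n : n = (s.+1 + h.+1)%N ->
  \sum_(f <- monics F n) (\sum_(g : {poly_h.+1 F}) ((vonMangoldt (f + val g))%:Z - 1)) ^+ 2
    <= (s.+1 ^ 2 * q ^ n * q ^ h.+1)%:Z.
Proof.
move=> ->; apply: (@interval_variance F s (fun f => (vonMangoldt f)%:Z - 1)) => i.
have nE : (s.+1 + h.+1 = (s + h.+1).+1)%N by [].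
have -> : charsum i (fun f => ((vonMangoldt f)%:Z - 1)%:~R) (s.+1 + h.+1) =
    charsum i (fun f => (vonMangoldt f)%:R) (s.+1 + h.+1) -
    charsum i (fun=> 1) (s.+1 + h.+1).
  by rewrite -sumrB; apply: eq_bigr => f _; rewrite rmorphB /= mulrBl.
apply: sqr_le_sqrtC; have [->|i0] := eqVneq i 0.
  rewrite charsum0_1 nE charsum0_vonMangoldt subrr normr0.
  by rewrite mulr_ge0 ?ler0n // exprn_ge0 // sqrtC_ge0 ler0n.
rewrite charsum1_eq0 ?subr0 //; last by lia.
by have [] := charsum_bound (s + h.+1) i0.
Qed.

Lemma moebius_variance s h n : n = (s.+1 + h.+1)%N ->
  \sum_(f <- monics F n) (\sum_(g : {poly_h.+1 F}) moebius (f + val g)) ^+ 2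
    <= ((n.+1 ^ s.+1) ^ 2 * q ^ n * q ^ h.+1)%:Z.
Proof.
move=> ->; apply: (@interval_variance F s (@moebius F)) => i.
apply: sqr_le_sqrtC; have [->|i0] := eqVneq i 0; last by have [_] := charsum_bound (s.+1 + h.+1) i0.
have -> : (s.+1 + h.+1 = (s + h).+2)%N by lia.
rewrite charsum0_moebius normr0.
by rewrite mulr_ge0 ?ler0n // exprn_ge0 // sqrtC_ge0 ler0n.
Qed.

Lemma sum_monic_npoly (R : nmodType) n (phi : {poly F} -> R) :
  \sum_(f : {poly_n.+1 F} | (val f \is monic) && (size (val f) == n.+1)) phi (val f) =
  \sum_(f <- monics F n) phi f.
Proof.
rewrite -big_filter -(big_map val xpredT); apply: perm_big; apply: uniq_perm.
- by rewrite map_inj_uniq ?filter_uniq ?index_enum_uniq //; exact: val_inj.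
- exact: monics_uniq.
move=> f; rewrite mem_monics; apply/mapP/idP => [[g + ->]|H].
  by rewrite mem_filter => /andP[].
have sf : (size f <= n.+1)%N by case/andP: H => _ /eqP ->.
exists (npolyp n.+1 f); last by rewrite /= npolypK.
by rewrite mem_filter mem_index_enum /= npolypK // H.
Qed.

Lemma monics_add n h f (g : {poly_h F}) : (h <= n)%N -> f \in monics F n ->
  f + val g \in monics F n.
Proof.
rewrite !mem_monics => hn /andP[mf /eqP sf].
have sg : (size (val g) < size f)%N by rewrite sf ltnS (leq_trans (size_npoly g)).
by rewrite monicE lead_coefDl // size_polyDl // sf eqxx andbT.
Qed.

(* Each of the [m - 2] extra factors is estimated trivially. *)
Lemma moment_le_variance (w : {poly F} -> int) m n h b c : (h.+1 <= n)%N -> (1 < m)%N ->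
  (forall f, f \in monics F n -> `|w f| <= b%:Z) ->
  \sum_(f <- monics F n) (\sum_(g : {poly_h.+1 F}) w (f + val g)) ^+ 2
    <= (c * q ^ n * q ^ h.+1)%:Z ->
  `| (q%:R : rat) ^- n * \sum_(f <- monics F n)
       (\sum_(g : {poly_h.+1 F}) (w (f + val g))%:~R) ^+ m |
    <= (b ^ (m - 2) * c)%:R * q%:R ^+ ((h + 1) * (m - 1)).
Proof.
move=> hn m1 wb var.
have q0 : 0 < (q%:R : rat) by rewrite ltr0n ltnW // card_gt1.
pose X f : int := \sum_(g : {poly_h.+1 F}) w (f + val g).
have Xb f : f \in monics F n -> `|X f| <= (b * q ^ h.+1)%:Z.
  move=> fn; apply: le_trans (ler_norm_sum _ _ _) _.
  apply: le_trans (ler_sum _ (fun g _ => wb _ (monics_add g hn fn))) _.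
  by rewrite sumr_const card_npoly -mulr_natr -natz -natrM natz.
have momZ : `|\sum_(f <- monics F n) X f ^+ m| <=
    ((b * q ^ h.+1) ^ (m - 2) * (c * q ^ n * q ^ h.+1))%:Z.
  apply: le_trans (ler_norm_sum _ _ _) _.
  rewrite PoszM; apply: le_trans (ler_wpM2l _ var) => //.
  rewrite mulr_sumr big_seq [X in _ <= X]big_seq ler_sum // => f fn.
  rewrite -{1}(subnK m1) exprD normrM [X in _ * X]ger0_norm ?sqr_ge0 //.
  rewrite ler_wpM2r ?sqr_ge0 // normrX -[Posz _]natz natrX natz.
  by rewrite lerXn2r ?nnegrE ?Xb.
have -> : \sum_(f <- monics F n) (\sum_(g : {poly_h.+1 F}) (w (f + val g))%:~R) ^+ m =
    (\sum_(f <- monics F n) X f ^+ m)%:~R :> rat.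
  rewrite rmorph_sum; apply: eq_bigr => f _; rewrite rmorphXn /= /X rmorph_sum //.
rewrite normrM normfV normrX (ger0_norm (ltW q0)) -intr_norm mulrC ler_pdivrMr ?exprn_gt0 //.
move: momZ; rewrite -(ler_int rat) => /le_trans; apply.
rewrite -pmulrn !(natrM, natrX) exprMn.
(* Each of the [m - 2] trivial estimates gives [h.+1] in the exponent, and the variance gives one
   more. *)
have -> : ((h + 1) * (m - 1) = h.+1 * (m - 2) + h.+1)%N by nia.
by rewrite exprD exprM le_eqVlt; apply/orP; left; apply/eqP; ring.
Qed.

End Moments.

Theorem theorem1p4 (m n h : nat) :
  (2 <= m)%N -> (4 <= n)%N -> (1 <= h)%N -> (h <= n - 3)%N ->
  exists C D : rat,
    forall F : finFieldType,
      ((2 < m)%N -> forall p : nat, p \in [pchar F] -> (n < p)%N) ->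
      let q : rat := (#|F|)%:R in
      `| q ^- n * \sum_(f : {poly_n.+1 F} | (val f \is monic) && (size (val f) == n.+1))
            (\sum_(g : {poly_h.+1 F})
                ((vonMangoldt (val f + val g))%:R - 1)) ^+ m |
        <= C * q ^+ ((h + 1) * (m - 1))
    /\
      `| q ^- n * \sum_(f : {poly_n.+1 F} | (val f \is monic) && (size (val f) == n.+1))
            (\sum_(g : {poly_h.+1 F}) (moebius (val f + val g))%:~R) ^+ m |
        <= D * q ^+ ((h + 1) * (m - 1)).
Proof.
(* Here [s.+1] is the number of coefficients, besides the leading one, that are constant on an
   interval. *)
move=> m2 n4 h1 hn; have [s nE] : exists s, n = (s.+1 + h.+1)%N.
  by exists (n - h - 2)%N; lia.
have hn' : (h.+1 <= n)%N by lia.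
(* The bases [n] and [1] bound the summands of the inner sums, and the squares come from the bounds
   for character sums. *)
exists (n ^ (m - 2) * s.+1 ^ 2)%:R, (1 ^ (m - 2) * (n.+1 ^ s.+1) ^ 2)%:R => F _ q; split.
  rewrite (sum_monic_npoly n (fun f => (\sum_(g : {poly_h.+1 F})
    ((vonMangoldt (f + val g))%:R - 1)) ^+ m)).
  rewrite (eq_bigr (fun f => (\sum_(g : {poly_h.+1 F})
    ((vonMangoldt (f + val g))%:Z - 1)%:~R) ^+ m)) => [|f _]; last first.
    by congr (_ ^+ _); apply: eq_bigr => g _; rewrite rmorphB.
  apply: (moment_le_variance (w := fun f => (vonMangoldt f)%:Z - 1)) => // [f|].
    rewrite mem_monics => /andP[mf /eqP sf].
    by have := vonMangoldt_le mf; rewrite sf /=; lia.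
  exact: (vonMangoldt_variance F nE).
rewrite (sum_monic_npoly n (fun f => (\sum_(g : {poly_h.+1 F})
  (moebius (f + val g))%:~R) ^+ m)).
apply: moment_le_variance => // [f _|]; first exact: moebius_norm.
exact: (moebius_variance F nE).
Qed.
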